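(* The implementation described below of the partition refinement algorithm for $\mathbf{EF}$ is correct (it outputs the coarsest partition refining the input partition $P_\ell$ that strongly preserves the language $\varphi::=p~|~\varphi_1\wedge\varphi_2~|~\neg\varphi~|~\mathrm{EF}\varphi$) and runs in $O(|\Sigma||\to|)$ time.
   Context: Let $(\Sigma,\to,\ell)$ be a finite Kripke structure with total transition relation $\to$ and $P_\ell$ the partition induced by the labeling. $\mathbf{EF}(S)$ is the set of states from which some state of $S$ is reachable via $\to$ (i.e. $\mathbf{EU}(\Sigma,S)$). The algorithm first computes, by Tarjan's depth-first algorithm, the DAG $(P_{\mathrm{scc}},\to_{\mathrm{scc}})$ of strongly connected components of $(\Sigma,\to)$. The current partition is kept as a doubly linked list of blocks, initially $P_\ell$, which is scanned from the beginning; for the current block $B$ it computes the set $B_{\mathrm{scc}}$ of s.c.c.'s meeting $B$, computes $S=\mathbf{EF}(B)=\bigcup\mathbf{EF}(B_{\mathrm{scc}})$ by a backward marking search in the DAG, and splits every block $C$ of the current partition into $C\cap S$ and $C\smallsetminus S$ (when both are nonempty), in time $O(|S|)$, moving the split blocks to the end of the list. The output is the final partition. *)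

(* Defs.v *)
From mathcomp Require Import all_boot.

Set Implicit Arguments.
Unset Strict Implicit.
Unset Printing Implicit Defensive.

Record kripke := Kripke {
  kstate :> finType;
  atom : Type;
  trans : rel kstate;
  trans_total : forall s, exists t, trans s t;
  label : kstate -> pred atom
}.

Definition EF (K : kripke) (S : {set K}) : {set K} :=
  [set s | [exists t in S, connect (@trans K) s t]].

Inductive form (A : Type) :=
| Atom of A
| And of form A & form A
| Neg of form A
| FEF of form A.

Fixpoint sem (K : kripke) (phi : form (atom K)) : {set K} :=
  match phi with
  | Atom p => [set s | label s p]
  | And phi1 phi2 => sem phi1 :&: sem phi2
  | Neg phi1 => ~: sem phi1
  | FEF phi1 => EF (sem phi1)
  end.

(* [P] is the partition of the states induced by the labeling.  It is a
   predicate because there may be infinitely many atoms, in which case equality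
   of labels is not a boolean. *)
Definition label_partition (K : kripke) (P : {set {set K}}) : Prop :=
  partition P [set: K] /\
  forall s t : K, (t \in pblock P s) <-> label s =1 label t.

Definition refines (T : finType) (P Q : {set {set T}}) : Prop :=
  forall B, B \in P -> exists2 C, C \in Q & B \subset C.

(* [P] refines the partition of the states induced by logical equivalence. *)
Definition strongly_preserves (K : kripke) (P : {set {set K}}) : Prop :=
  forall B, B \in P -> forall s t, s \in B -> t \in B ->
  forall phi : form (atom K), (s \in sem phi) = (t \in sem phi).

Definition coarsest_strongly_preserving (K : kripke) (P0 P : {set {set K}}) :=
  [/\ partition P [set: K], refines P P0, strongly_preserves P &
      forall Q, partition Q [set: K] -> refines Q P0 -> strongly_preserves Q ->
        refines Q P].

(** * A unit-cost random access machine *)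

(* A while language over registers and unbounded arrays of naturals.  The only
   arithmetic is successor and predecessor, so in t steps the largest value in
   memory grows by at most a constant times t, and unit cost is not abused.  One assignment or one test costs 1: a program is a fixed term, so
   the size of its expressions is a constant. *)

Inductive reg :=
| v_n | v_m                                 (* |states| and |transitions| *)
| v_i | v_j | v_k                           (* loop indices *)
| v_cur | v_u | v_w | v_e | v_cnt | v_tp | v_nc      (* Tarjan *)
| v_c | v_d                                 (* components *)
| v_x | v_sp | v_now | v_len                (* marking *)
| v_B | v_C | v_D | v_s | v_p | v_q
| v_nb | v_first | v_last | v_ntouch.       (* blocks *)

Inductive arr :=
| a_src | a_tgt                             (* endpoints of a transition *)
| a_ahead | a_anext                         (* outgoing transitions *)
| a_num | a_low | a_ptr | a_par | a_tstack  (* Tarjan *)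
| a_comp | a_chead | a_cnext                (* component of a state; its states *)
| a_dsrc | a_dhead | a_dnext                (* predecessors in the DAG *)
| a_blk                                     (* block of a state *)
| a_mhead | a_mnext | a_mprev | a_size      (* states of a block *)
| a_bnext | a_bprev                         (* list of blocks *)
| a_mark | a_work | a_reach                 (* backward marking *)
| a_seen | a_hit | a_touch | a_twin.        (* splitting *)

Definition reg_eq_dec (x y : reg) : {x = y} + {x <> y}.
Proof. by decide equality. Defined.

Definition arr_eq_dec (x y : arr) : {x = y} + {x <> y}.
Proof. by decide equality. Defined.

Inductive exp := Cst of nat | Val of loc | Succ of exp | Prec of exp
with loc := Reg of reg | Cell of arr & exp.

Inductive test := Eq of exp & exp | Lt of exp & exp | Not of test.

Inductive cmd :=
| Skip
| Assign of loc & exp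
| Seq of cmd & cmd
| If of test & cmd & cmd
| While of test & cmd.

Record memory := Memory { regs : reg -> nat; arrs : arr -> nat -> nat }.

Fixpoint eval_exp (m : memory) (e : exp) : nat :=
  match e with
  | Cst n => n
  | Val l => eval_loc m l
  | Succ e1 => (eval_exp m e1).+1
  | Prec e1 => (eval_exp m e1).-1
  end
with eval_loc (m : memory) (l : loc) : nat :=
  match l with
  | Reg x => regs m x
  | Cell a e => arrs m a (eval_exp m e)
  end.

Fixpoint eval_test (m : memory) (b : test) : bool :=
  match b with
  | Eq e1 e2 => eval_exp m e1 == eval_exp m e2
  | Lt e1 e2 => eval_exp m e1 < eval_exp m e2
  | Not b1 => ~~ eval_test m b1
  end.

Definition store (m : memory) (l : loc) (v : nat) : memory :=
  match l with
  | Reg x => Memory (fun y => if reg_eq_dec y x then v else regs m y) (arrs m)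
  | Cell a e =>
      let i := eval_exp m e in
      Memory (regs m)
        (fun b j => if arr_eq_dec b a && (j == i) then v else arrs m b j)
  end.

(* [exec c m t m']: run from [m], [c] terminates in [m'] after [t] steps.  This
   is deterministic: [t] and [m'] are functions of [c] and [m]. *)
Inductive exec : cmd -> memory -> nat -> memory -> Prop :=
| ExecSkip m : exec Skip m 0 m
| ExecAssign l e m : exec (Assign l e) m 1 (store m l (eval_exp m e))
| ExecSeq c1 c2 m1 t1 m2 t2 m3 :
    exec c1 m1 t1 m2 -> exec c2 m2 t2 m3 ->
    exec (Seq c1 c2) m1 (t1 + t2) m3
| ExecIfTrue b c1 c2 m t m' :
    eval_test m b -> exec c1 m t m' -> exec (If b c1 c2) m t.+1 m'
| ExecIfFalse b c1 c2 m t m' :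
    ~~ eval_test m b -> exec c2 m t m' -> exec (If b c1 c2) m t.+1 m'
| ExecWhileFalse b c m :
    ~~ eval_test m b -> exec (While b c) m 1 m
| ExecWhileTrue b c m1 t1 m2 t2 m3 :
    eval_test m1 b -> exec c m1 t1 m2 -> exec (While b c) m2 t2 m3 ->
    exec (While b c) m1 (t1 + t2).+1 m3.

Coercion Cst : nat >-> exp.
Coercion Val : loc >-> exp.
Coercion Reg : reg >-> loc.

Declare Scope cmd_scope.
Delimit Scope cmd_scope with cmd.
Bind Scope cmd_scope with cmd exp loc test.

Notation "a !! e" := (Cell a e) (at level 2, e at level 1) : cmd_scope.
Notation "e .+1" := (Succ e) : cmd_scope.
Notation "e .-1" := (Prec e) : cmd_scope.
Notation "e1 == e2" := (Eq e1 e2) : cmd_scope.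
Notation "e1 != e2" := (Not (Eq e1 e2)) : cmd_scope.
Notation "e1 < e2" := (Lt e1 e2) : cmd_scope.
Notation "l <~ e" := (Assign l e) (at level 75, no associativity) : cmd_scope.
Notation "c1 ;; c2" := (Seq c1 c2)
  (at level 90, right associativity) : cmd_scope.
Notation "'IF' b 'THEN' c1 'ELSE' c2 'FI'" := (If b c1 c2)
  (at level 0, b, c1, c2 at level 200) : cmd_scope.
Notation "'IF' b 'THEN' c1 'FI'" := (If b c1 Skip)
  (at level 0, b, c1 at level 200) : cmd_scope.
Notation "'WHILE' b 'DO' c 'DONE'" := (While b c)
  (at level 0, b, c at level 200) : cmd_scope.
Notation "'FOR' i 'BELOW' e 'DO' c 'DONE'" :=
  (Seq (Assign i (Cst 0))
       (While (Lt i e) (Seq c (Assign i (Succ i)))))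
  (at level 0, i, e at level 1, c at level 200) : cmd_scope.

(** * The implementation *)

(* States, transitions and blocks are numbered from 0, components from 1.  In
   links ([a_*head], [a_*next], [a_*prev], [a_par], [a_ptr], [a_twin], [v_cur],
   [v_first], [v_last], [v_x], [v_p], [v_q]) an item i is coded by i.+1, and 0
   means that there is none. *)

Local Open Scope cmd_scope.

Definition build_successors : cmd :=
  FOR v_j BELOW v_m DO
    a_anext!!v_j <~ a_ahead!!(a_src!!v_j) ;;
    a_ahead!!(a_src!!v_j) <~ v_j.+1
  DONE.

(* Tarjan's algorithm, with an explicit call stack linked by [a_par].  A visited
   state is on the stack [a_tstack] iff it has no component yet. *)

Definition tarjan_visit (w : reg) : cmd :=
  v_cnt <~ v_cnt.+1 ;;
  a_num!!w <~ v_cnt ;;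
  a_low!!w <~ v_cnt ;;
  a_ptr!!w <~ a_ahead!!w ;;
  a_par!!w <~ v_cur ;;
  a_tstack!!v_tp <~ w ;;
  v_tp <~ v_tp.+1 ;;
  v_cur <~ w.+1.

Definition tarjan_pop_component : cmd :=
  v_nc <~ v_nc.+1 ;;
  WHILE a_comp!!v_u == 0 DO
    v_tp <~ v_tp.-1 ;;
    v_w <~ a_tstack!!v_tp ;;
    a_comp!!v_w <~ v_nc ;;
    a_cnext!!v_w <~ a_chead!!v_nc ;;
    a_chead!!v_nc <~ v_w.+1
  DONE.

Definition tarjan : cmd :=
  FOR v_i BELOW v_n DO
    IF a_num!!v_i == 0 THEN
      v_cur <~ 0 ;;
      tarjan_visit v_i ;;
      WHILE v_cur != 0 DO
        v_u <~ v_cur.-1 ;;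
        v_e <~ a_ptr!!v_u ;;
        IF v_e != 0 THEN
          a_ptr!!v_u <~ a_anext!!(v_e.-1) ;;
          v_w <~ a_tgt!!(v_e.-1) ;;
          IF a_num!!v_w == 0 THEN
            tarjan_visit v_w
          ELSE
            IF a_comp!!v_w == 0 THEN
              IF a_num!!v_w < a_low!!v_u THEN a_low!!v_u <~ a_num!!v_w FI
            FI
          FI
        ELSE
          IF a_low!!v_u == a_num!!v_u THEN tarjan_pop_component FI ;;
          v_cur <~ a_par!!v_u ;;
          IF v_cur != 0 THEN
            IF a_low!!v_u < a_low!!(v_cur.-1) THEN
              a_low!!(v_cur.-1) <~ a_low!!v_u
            FI
          FI
        FI
      DONE
    FI
  DONE.

(* The predecessors of component d are [a_dsrc!!j] for the items j of the list
   [a_dhead!!d], one for each transition j entering d from another component. *)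
Definition build_dag : cmd :=
  FOR v_j BELOW v_m DO
    v_c <~ a_comp!!(a_src!!v_j) ;;
    v_d <~ a_comp!!(a_tgt!!v_j) ;;
    IF v_c != v_d THEN
      a_dsrc!!v_j <~ v_c ;;
      a_dnext!!v_j <~ a_dhead!!v_d ;;
      a_dhead!!v_d <~ v_j.+1
    FI
  DONE.

Definition append_block (b : reg) : cmd :=
  a_bprev!!b <~ v_last ;;
  a_bnext!!b <~ 0 ;;
  IF v_last == 0 THEN
    v_first <~ b.+1
  ELSE
    a_bnext!!(v_last.-1) <~ b.+1
  FI ;;
  v_last <~ b.+1.

Definition remove_block (b : reg) : cmd :=
  v_p <~ a_bprev!!b ;;
  v_q <~ a_bnext!!b ;;
  IF v_p == 0 THEN v_first <~ v_q ELSE a_bnext!!(v_p.-1) <~ v_q FI ;;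
  IF v_q == 0 THEN v_last <~ v_p ELSE a_bprev!!(v_q.-1) <~ v_p FI.

Definition insert_state (s b : reg) : cmd :=
  v_q <~ a_mhead!!b ;;
  a_mprev!!s <~ 0 ;;
  a_mnext!!s <~ v_q ;;
  IF v_q != 0 THEN a_mprev!!(v_q.-1) <~ s.+1 FI ;;
  a_mhead!!b <~ s.+1 ;;
  a_size!!b <~ (a_size!!b).+1 ;;
  a_blk!!s <~ b.

Definition delete_state (s b : reg) : cmd :=
  v_p <~ a_mprev!!s ;;
  v_q <~ a_mnext!!s ;;
  IF v_p == 0 THEN a_mhead!!b <~ v_q ELSE a_mnext!!(v_p.-1) <~ v_q FI ;;
  IF v_q != 0 THEN a_mprev!!(v_q.-1) <~ v_p FI ;;
  a_size!!b <~ (a_size!!b).-1.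

Definition build_blocks : cmd :=
  v_nb <~ v_n ;;
  FOR v_i BELOW v_n DO
    v_B <~ a_blk!!v_i ;;
    IF a_mhead!!v_B == 0 THEN append_block v_B FI ;;
    insert_state v_i v_B
  DONE.

(* Marks are time stamps: component c is marked iff [a_mark!!c] is [v_now]. *)
Definition mark (c : reg) : cmd :=
  IF a_mark!!c != v_now THEN
    a_mark!!c <~ v_now ;;
    a_work!!v_sp <~ c ;;
    v_sp <~ v_sp.+1
  FI.

(* Marks the components meeting block [v_B]. *)
Definition mark_block_components : cmd :=
  v_now <~ v_now.+1 ;;
  v_sp <~ 0 ;;
  v_x <~ a_mhead!!v_B ;;
  WHILE v_x != 0 DO
    v_c <~ a_comp!!(v_x.-1) ;;
    mark v_c ;;
    v_x <~ a_mnext!!(v_x.-1)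
  DONE.

(* Backward search in the DAG; the states of the marked components are stored in
   [a_reach!!0], [a_reach!!1], and so on up to [v_len], excluded. *)
Definition collect_EF : cmd :=
  v_len <~ 0 ;;
  WHILE v_sp != 0 DO
    v_sp <~ v_sp.-1 ;;
    v_d <~ a_work!!v_sp ;;
    v_x <~ a_chead!!v_d ;;
    WHILE v_x != 0 DO
      a_reach!!v_len <~ v_x.-1 ;;
      v_len <~ v_len.+1 ;;
      v_x <~ a_cnext!!(v_x.-1)
    DONE ;;
    v_x <~ a_dhead!!v_d ;;
    WHILE v_x != 0 DO
      v_c <~ a_dsrc!!(v_x.-1) ;;
      mark v_c ;;
      v_x <~ a_dnext!!(v_x.-1)
    DONE
  DONE.

(* Splits every block with respect to the collected set S: list the blocks C
   meeting S, with [a_hit!!C] the number of states of C in S; for those not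
   included in S, create an empty block [a_twin!!C] and move both to the end of
   the list of blocks; finally move the states of S to the twins. *)
Definition split : cmd :=
  v_ntouch <~ 0 ;;
  FOR v_k BELOW v_len DO
    v_C <~ a_blk!!(a_reach!!v_k) ;;
    IF a_seen!!v_C != v_now THEN
      a_seen!!v_C <~ v_now ;;
      a_hit!!v_C <~ 0 ;;
      a_touch!!v_ntouch <~ v_C ;;
      v_ntouch <~ v_ntouch.+1
    FI ;;
    a_hit!!v_C <~ (a_hit!!v_C).+1
  DONE ;;
  FOR v_k BELOW v_ntouch DO
    v_C <~ a_touch!!v_k ;;
    IF a_hit!!v_C < a_size!!v_C THEN
      v_D <~ v_nb ;;
      v_nb <~ v_nb.+1 ;;
      a_twin!!v_C <~ v_D.+1 ;;
      remove_block v_C ;;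
      append_block v_D ;;
      append_block v_C
    ELSE
      a_twin!!v_C <~ 0
    FI
  DONE ;;
  FOR v_k BELOW v_len DO
    v_s <~ a_reach!!v_k ;;
    v_C <~ a_blk!!v_s ;;
    IF a_twin!!v_C != 0 THEN
      v_D <~ (a_twin!!v_C).-1 ;;
      delete_state v_s v_C ;;
      insert_state v_s v_D
    FI
  DONE.

Definition refine_EF : cmd :=
  build_successors ;;
  tarjan ;;
  build_dag ;;
  build_blocks ;;
  v_cur <~ v_first ;;
  WHILE v_cur != 0 DO
    v_B <~ v_cur.-1 ;;
    mark_block_components ;;
    collect_EF ;;
    split ;;
    v_cur <~ a_bnext!!v_B
  DONE.

Local Close Scope cmd_scope.

(** * Input and output *)

Definition transitions (K : kripke) : {set K * K} :=
  [set e | trans e.1 e.2].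

Definition state_number (K : kripke) (s : K) : nat := enum_rank s.

(* [es] enumerates the transitions and [blk] names the block of each state in
   the partition [P]. *)
Definition is_input (K : kripke) (P : {set {set K}}) (es : seq (K * K))
    (blk : K -> nat) : Prop :=
  [/\ uniq es, es =i transitions K,
      forall s, blk s < #|K| &
      forall s t, (blk s == blk t) = (t \in pblock P s)].

Definition input_memory (K : kripke) (es : seq (K * K)) (blk : K -> nat) :=
  Memory
    (fun x => match x with v_n => #|K| | v_m => size es | _ => 0 end)
    (fun a => match a with
     | a_src => nth 0 [seq state_number e.1 | e <- es]
     | a_tgt => nth 0 [seq state_number e.2 | e <- es]
     | a_blk => nth 0 [seq blk s | s <- enum K]
     | _ => fun _ => 0
     end).

(* [xs] is the list of items that starts at link [h]. *)
Fixpoint linked_list (next : nat -> nat) (h : nat) (xs : seq nat) : Prop :=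
  match xs with
  | [::] => h = 0
  | x :: xs' => h = x.+1 /\ linked_list next (next x) xs'
  end.

(* [P] is the set of the blocks on the list of blocks, each given by its list of
   states. *)
Definition is_output (K : kripke) (m : memory) (P : {set {set K}}) : Prop :=
  exists (bs : seq nat) (members : nat -> seq nat),
  [/\ linked_list (arrs m a_bnext) (regs m v_first) bs,
      forall b, b \in bs ->
        linked_list (arrs m a_mnext) (arrs m a_mhead b) (members b) &
      P = [set B in [seq [set s : K | state_number s \in members b]
                    | b <- bs]]].

(* Main.v *)
Require Import Defs.
From mathcomp Require Import all_boot.
From mathcomp Require Import zify.
From Stdlib Require Import Classical.

(* Only the soundness of Tarjan's algorithm matters: states of one component
   reach each other, so marking components backwards from those meeting B
   collects exactly EF(B), whether or not components are maximal.  The stack is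
   cut into one segment per pending call; a finished state of a segment reaches
   a strictly older state of the stack, so when low(u) = num(u) the segment of u
   is strongly connected.

   Since B is contained in EF(B), the current block is never split.  A split
   block is moved to the end of the list, so at all times every partition class
   is contained in or disjoint from EF(B) for each block B that precedes the
   cursor; at the end this holds for all blocks, and as EF commutes with unions
   the partition strongly preserves the language.  It is the coarsest one
   because every block is definable by a formula.

   A split adds one block and two entries ahead of the cursor, so
   (entries ahead) + 2 (|states| - |blocks|) decreases at each of the at most
   2 |states| iterations, each of which costs O(|states| + |transitions|);
   and |states| <= |transitions| by totality. *)

Set Implicit Arguments.
Unset Strict Implicit.
Unset Printing Implicit Defensive.

(** * A time-aware program logic *)

(** Correctness and running time are proved together: a run is exhibited, and one postcondition
    speaks of its length and of its final memory. The obstacle is that multiplying the bounds of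
    nested loops gives too much: one expansion in the backward search may cost $n+M$, and there may
    be $n$ of them. Each loop therefore carries a potential over ghost data that record what is
    already consumed (visited states, traversed transitions, expanded components). Repetition-free
    lists with entries in a finite range then give linear bounds.

    The algorithm is verified on natural numbers, for an abstract relation [R] and an abstract
    closure property [definable]. Reachability in the Kripke structure and formulas enter only at
    the end, through the numbering of states. There may be infinitely many atoms, so a class of the
    initial partition is not defined by a conjunction over atoms: only finitely many states must be
    separated from it, each by one atom that is chosen classically. *)

Definition wp (c : cmd) (m : memory) (Q : nat -> memory -> Prop) : Prop :=
  exists t m', exec c m t m' /\ Q t m'.

Lemma wp_conseq c m (Q Q' : nat -> memory -> Prop) :
  wp c m Q -> (forall t m', Q t m' -> Q' t m') -> wp c m Q'.
Proof. by move=> [t [m' [e q]]] QQ'; exists t, m'; split=> //; apply: QQ'. Qed.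

Lemma wp_seq c1 c2 m (Q : nat -> memory -> Prop) :
  wp c1 m (fun t1 m1 => wp c2 m1 (fun t2 m2 => Q (t1 + t2) m2)) ->
  wp (Seq c1 c2) m Q.
Proof.
move=> [t1 [m1 [e1 [t2 [m2 [e2 q]]]]]].
by exists (t1 + t2), m2; split=> //; apply: ExecSeq e1 e2.
Qed.

(** Computable on loop-free code, so that simplification runs a program symbolically. At a loop it
    falls back to [wp], where an invariant has to be supplied. *)
Fixpoint wpf (c : cmd) (m : memory) (Q : nat -> memory -> Prop) : Prop :=
  match c with
  | Skip => Q 0 m
  | Assign l e => Q 1 (store m l (eval_exp m e))
  | Seq c1 c2 => wpf c1 m (fun t1 m1 => wpf c2 m1 (fun t2 m2 => Q (t1 + t2) m2))
  | If b c1 c2 =>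
      if eval_test m b then wpf c1 m (fun t => Q t.+1)
      else wpf c2 m (fun t => Q t.+1)
  | While b c => wp (While b c) m Q
  end.

Lemma wpfW c m Q : wpf c m Q -> wp c m Q.
Proof.
elim: c m Q => [|l e|c1 IH1 c2 IH2|b c1 IH1 c2 IH2|b c _] m Q //=.
- by exists 0, m; split=> //; constructor.
- by move=> q; exists 1, (store m l (eval_exp m e)); split=> //; constructor.
- move=> /IH1 w; apply: wp_seq; apply: wp_conseq w _ => t m1; exact: IH2.
- case: ifPn => b_m.
    move=> /IH1[t [m' [e q]]]; exists t.+1, m'; split=> //.
    exact: ExecIfTrue.
  move=> /IH2[t [m' [e q]]]; exists t.+1, m'; split=> //.
  exact: ExecIfFalse.
Qed.

Fixpoint writes_reg (c : cmd) (r : reg) : bool :=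
  match c with
  | Skip => false
  | Assign (Reg x) _ => reg_eq_dec r x
  | Assign _ _ => false
  | Seq c1 c2 | If _ c1 c2 => writes_reg c1 r || writes_reg c2 r
  | While _ c1 => writes_reg c1 r
  end.

Fixpoint writes_arr (c : cmd) (a : arr) : bool :=
  match c with
  | Skip => false
  | Assign (Cell b _) _ => arr_eq_dec a b
  | Assign _ _ => false
  | Seq c1 c2 | If _ c1 c2 => writes_arr c1 a || writes_arr c2 a
  | While _ c1 => writes_arr c1 a
  end.

(** A purely syntactic frame condition: each use is discharged by evaluation ([isT]), and a loop
    invariant needs to mention only the memory that the loop modifies. *)
Definition frame (c : cmd) (m m' : memory) : Prop :=
  (forall r, ~~ writes_reg c r -> regs m' r = regs m r) /\
  (forall a, ~~ writes_arr c a -> arrs m' a = arrs m a).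

Lemma frame_refl c m : frame c m m.
Proof. by []. Qed.

Lemma frame_trans c m1 m2 m3 : frame c m1 m2 -> frame c m2 m3 -> frame c m1 m3.
Proof.
move=> [r12 a12] [r23 a23].
by split=> x w; [rewrite r23 // r12 | rewrite a23 // a12].
Qed.

Lemma exec_frame c m t m' : exec c m t m' -> frame c m m'.
Proof.
elim=> {c m t m'}.
- by move=> m; exact: frame_refl.
- move=> [x|a e'] e m; split=> //= y; first by case: reg_eq_dec.
  by case: arr_eq_dec.
- move=> c1 c2 m1 t1 m2 t2 m3 _ [r1 a1] _ [r2 a2].
  by split=> x /=; rewrite negb_or => /andP[w1 w2]; rewrite ?r2 ?a2 ?r1 ?a1.
- move=> b c1 c2 m t m' _ _ [r1 a1].
  by split=> x /=; rewrite negb_or => /andP[w1 w2]; rewrite ?r1 ?a1.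
- move=> b c1 c2 m t m' _ _ [r1 a1].
  by split=> x /=; rewrite negb_or => /andP[w1 w2]; rewrite ?r1 ?a1.
- by move=> b c m _; exact: frame_refl.
- move=> b c m1 t1 m2 t2 m3 _ _ f1 _ f2; exact: frame_trans f1 f2.
Qed.

Lemma wp_frame c m Q :
  wp c m Q -> wp c m (fun t m' => Q t m' /\ frame c m m').
Proof.
move=> [t [m' [e q]]]; exists t, m'; split=> //; split=> //; exact: exec_frame e.
Qed.

(* [phi] is a potential: it pays for the time of the remaining iterations. *)
Lemma wp_while (G : Type) (I : G -> memory -> Prop) (phi : G -> nat) b c m0 g0 Q :
  I g0 m0 ->
  (forall g m, I g m -> frame c m0 m -> eval_test m b ->
     wp c m (fun t m' => exists2 g', I g' m' & t.+1 + phi g' <= phi g)) ->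
  (forall g m t, I g m -> frame c m0 m -> ~~ eval_test m b ->
     t + phi g <= (phi g0).+1 -> Q t m) ->
  wp (While b c) m0 Q.
Proof.
move=> I0 step exit.
(* The elapsed time [s] is carried along, so that the exit condition can refer to the initial
   potential. The extra unit there is the last, failing test. *)
suff gen g m s : I g m -> frame c m0 m -> s + phi g <= phi g0 ->
    wp (While b c) m (fun t m' => Q (s + t) m').
  by apply: wp_conseq (gen g0 m0 0 I0 (frame_refl c m0) (leqnn _)) _.
have [k] := ubnP (phi g).
elim: k g m s => // k IH g m s lek Ig fr les.
have [b_m | b_m] := boolP (eval_test m b); last first.
  exists 1, m; split; first exact: ExecWhileFalse.
  apply: (exit g) => //; lia.
have [t1 [m1 [e1 [g1 I1 le1]]]] := step g m Ig fr b_m.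
have fr1 : frame c m m1 := exec_frame e1.
have [||t2 [m2 [e2 q]]] := IH g1 m1 (s + t1.+1) _ I1 (frame_trans fr fr1).
- lia.
- lia.
exists (t1 + t2).+1, m2; split; first exact: ExecWhileTrue b_m e1 e2.
by move: q; rewrite -addnA addSn.
Qed.

(** * Linked lists *)

Definition upd (f : nat -> nat) (i v : nat) : nat -> nat :=
  fun j => if j == i then v else f j.

Lemma upd_same f i v : upd f i v i = v.
Proof. by rewrite /upd eqxx. Qed.

Lemma upd_other f i v j : j != i -> upd f i v j = f j.
Proof. by rewrite /upd => /negPf->. Qed.

(** Both sides are additive, so no truncated subtraction arises when potentials are compared. *)
Lemma sum_upd n u (f g : nat -> nat) :
  u < n -> (forall x, x != u -> g x = f x) ->
  \sum_(0 <= i < n) g i + f u = \sum_(0 <= i < n) f i + g u.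
Proof.
move=> ltun fg.
have split_at h : \sum_(0 <= i < n) h i = h u + \sum_(i < n | i != Ordinal ltun) h i.
  by rewrite big_mkord (bigD1 (Ordinal ltun)).
rewrite !split_at (eq_bigr (fun i : 'I_n => f i)).
  by set S := bigop _ _ _; rewrite addnC addnA addnAC [f u + _ + _]addnAC. 
by move=> i neq; apply: fg; apply: contra neq => /eqP e; apply/eqP/val_inj.
Qed.

Lemma linked_list_ext next next' h xs :
  {in xs, next =1 next'} -> linked_list next h xs -> linked_list next' h xs.
Proof.
elim: xs h => //= x xs IH h e [-> l]; split=> //.
rewrite -e ?mem_head //; apply: IH => // y xs_y.
by apply: e; rewrite inE xs_y orbT.
Qed.

Lemma linked_list_nz next h xs :
  linked_list next h xs -> h <> 0 ->
  exists xs', xs = h.-1 :: xs' /\ linked_list next (next h.-1) xs'.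
Proof. by case: xs => //= x xs [-> l] _; exists xs. Qed.

Lemma linked_list0 next xs : linked_list next 0 xs -> xs = [::].
Proof. by case: xs => // x xs []. Qed.

Definition linked_lists next head (f : nat -> seq nat) : Prop :=
  forall c, linked_list next (head c) (f c).

Lemma linked_lists_eq next head f g :
  f =1 g -> linked_lists next head f -> linked_lists next head g.
Proof. by move=> fg l c; rewrite -fg. Qed.

Definition cons_at (f : nat -> seq nat) (k x : nat) : nat -> seq nat :=
  fun c => if c == k then x :: f c else f c.

(** The new item lies in none of the lists that share [next], so overwriting its link disturbs none
    of them. *)
Lemma linked_lists_push next head f k x :
  (forall c, x \notin f c) -> linked_lists next head f ->
  linked_lists (upd next x (head k)) (upd head k x.+1) (cons_at f k x).
Proof.
move=> nfx l c; rewrite /cons_at {2}/upd.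
have ext : linked_list (upd next x (head k)) (head c) (f c).
  apply: linked_list_ext (l c) => y fy; rewrite upd_other //.
  by apply: contraNneq (nfx c) => <-.
by case: eqP ext => [->|//] ext; split=> //; rewrite upd_same.
Qed.

(** * Doubly linked lists *)

(** A segment with open ends: [p] is the link before it and [q] the link after it, [h] and [l] lead
    to its first and last items, and an empty segment identifies [h] with [q] and [p] with [l].
    Segments can thus be cut and glued ([dseg_cat]); a whole list has [p = 0] and [q = 0]. *)
Fixpoint dseg (nx pv : nat -> nat) p h xs l q : Prop :=
  match xs with
  | [::] => h = q /\ p = l
  | x :: xs' => [/\ h = x.+1, pv x = p & dseg nx pv x.+1 (nx x) xs' l q]
  end.

Lemma dseg_ext nx pv nx' pv' p h xs l q :
  {in xs, nx =1 nx'} -> {in xs, pv =1 pv'} ->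
  dseg nx pv p h xs l q -> dseg nx' pv' p h xs l q.
Proof.
elim: xs p h => //= x xs IH p h en ep [-> pvx d]; split=> //.
  by rewrite -ep ?mem_head.
rewrite -en ?mem_head //; apply: IH d => y xs_y; [apply: en|apply: ep];
  by rewrite inE xs_y orbT.
Qed.

Lemma dseg_cat nx pv p h xs ys l q :
  dseg nx pv p h (xs ++ ys) l q <->
  exists l' q', dseg nx pv p h xs l' q' /\ dseg nx pv l' q' ys l q.
Proof.
elim: xs p h => [|x xs IH] p h /=.
  by split=> [d|[l' [q' [[-> ->]]]]//]; exists p, h.
split=> [[-> pvx /IH[l' [q' [d1 d2]]]]|[l' [q' [[-> pvx d1] d2]]]].
  by exists l', q'.
by split=> //; apply/IH; exists l', q'.
Qed.

Lemma dseg_linked nx pv p h xs l : dseg nx pv p h xs l 0 -> linked_list nx h xs.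
Proof. by elim: xs p h => [|x xs IH] p h /=; [case|case=> -> _ /IH]. Qed.

Lemma dseg_set_last nx pv p h xs l q q' :
  uniq xs -> xs != [::] -> dseg nx pv p h xs l q ->
  [/\ 0 < l, l.-1 \in xs & dseg (upd nx l.-1 q') pv p h xs l q'].
Proof.
case/lastP: xs => // xs x; rewrite rcons_uniq => /andP[nx_x _] _.
rewrite -cats1 => /dseg_cat[l' [q1 [d [q1E pvx [_ <-]]]]] /=; subst q1.
split=> //; first by rewrite mem_cat inE eqxx orbT.
apply/dseg_cat; exists l', x.+1; split; last by rewrite /= upd_same.
apply: dseg_ext d => // y xs_y; rewrite upd_other //.
by apply: contraNneq nx_x => <-.
Qed.

Lemma dseg_set_head nx pv p h xs l q p' :
  uniq xs -> xs != [::] -> dseg nx pv p h xs l q ->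
  [/\ 0 < h, h.-1 \in xs & dseg nx (upd pv h.-1 p') p' h xs l q].
Proof.
case: xs => // x xs /=/andP[nx_x _] _ [-> pvx d] /=.
split=> //; first by rewrite mem_head.
split; rewrite ?upd_same //.
apply: dseg_ext d => // y xs_y; rewrite upd_other //.
by apply: contraNneq nx_x => <-.
Qed.

Lemma dseg_nil nx pv h xs l q : dseg nx pv 0 h xs l q -> (l == 0) = (xs == [::]).
Proof.
case/lastP: xs => [[_ <-]|xs x]; first by rewrite !eqxx.
rewrite -cats1 => /dseg_cat[l' [q1 [_ [_ _ [_ <-]]]]] /=.
by case: (xs).
Qed.

Lemma dseg_head_nil nx pv p h xs l : dseg nx pv p h xs l 0 -> (h == 0) = (xs == [::]).
Proof. by case: xs => [[-> _]|x xs /=[->]]. Qed.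

(** The new links are written with the conditionals of the program, so that the lemma serves both
    the list of blocks and the lists of states. Cut at [b], the list has two disjoint halves: one
    write changes the end of the left half, the other the start of the right half. *)
Lemma dseg_remove nx pv h l xs b ys p q :
  uniq (xs ++ b :: ys) -> dseg nx pv 0 h (xs ++ b :: ys) l 0 ->
  p = pv b -> q = nx b ->
  [/\ p != 0 -> p.-1 \in xs, q != 0 -> q.-1 \in ys &
  dseg (if p == 0 then nx else upd nx p.-1 q) (if q == 0 then pv else upd pv q.-1 p)
    0 (if p == 0 then q else h) (xs ++ ys) (if q == 0 then p else l) 0].
Proof.
rewrite cat_uniq /= => /and3P[uxs /norP[nxsb dis] /andP[nysb uys]].
move=> /dseg_cat[l' [q' [d1 [_ pvb d2]]]] -> -> {p q}; rewrite pvb.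
have nb y : y \in xs -> y \in ys -> False.
  by move=> xs_y ys_y; case/negP: dis; apply/hasP; exists y.
have e1 := dseg_nil d1; have e2 := dseg_head_nil d2.
have [d1' l'_xs] : dseg (if l' == 0 then nx else upd nx l'.-1 (nx b)) pv 0
   (if l' == 0 then nx b else h) xs l' (nx b) /\ (l' != 0 -> l'.-1 \in xs).
  case: ifPn e1 => [/eqP z|nz] /esym e1.
    by move: d1; rewrite z (eqP e1) /=; case.
  by have [] := dseg_set_last (nx b) uxs (negbT e1) d1.
have [d2' q_ys] : dseg nx (if nx b == 0 then pv else upd pv (nx b).-1 l') l' (nx b) ys
   (if nx b == 0 then l' else l) 0 /\ (nx b != 0 -> (nx b).-1 \in ys).
  case: ifPn e2 => [/eqP z|nz] /esym e2.
    by rewrite z (eqP e2).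
  by have [] := dseg_set_head l' uys (negbT e2) d2.
split=> //; apply/dseg_cat; exists l', (nx b); split.
  apply: dseg_ext d1' => // y xs_y; case: ifPn => // /q_ys ys_q.
  by rewrite upd_other //; apply/eqP=> e; apply: (nb y) => //; rewrite e.
apply: dseg_ext d2' => // y ys_y; case: ifPn => // /l'_xs xs_q.
by rewrite upd_other //; apply/eqP=> e; apply: (nb y) => //; rewrite e.
Qed.

Lemma dseg_append nx pv h xs l b :
  uniq xs -> b \notin xs -> dseg nx pv 0 h xs l 0 ->
  dseg (if l == 0 then upd nx b 0 else upd (upd nx b 0) l.-1 b.+1) (upd pv b l)
    0 (if l == 0 then b.+1 else h) (rcons xs b) b.+1 0.
Proof.
move=> uxs nxs d; have e := dseg_nil d.
have d1 : dseg (upd nx b 0) (upd pv b l) 0 h xs l 0.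
  by apply: dseg_ext d => // y xs_y; rewrite upd_other //; apply: contraNneq nxs => <-.
rewrite -cats1; case: ifPn e => [/eqP z /esym/eqP xs0|nz /esym xs0].
  by subst; rewrite /= !upd_same.
have [l0 xs_l d2] := dseg_set_last b.+1 uxs (negbT xs0) d1.
apply/dseg_cat; exists l, b.+1; split=> //=; rewrite upd_same; split=> //.
rewrite upd_other ?upd_same //; by apply: contraNneq nxs => ->.
Qed.

(** The predicate [dom] tells which states are stored at the moment: it grows while the blocks are
    built, and loses one state between a deletion and the insertion that follows. *)
Definition members_ok (dom : pred nat) (blk nx pv hd sz : nat -> nat) : Prop :=
  exists mem : nat -> seq nat, forall b,
  [/\ exists l, dseg nx pv 0 (hd b) (mem b) l 0, uniq (mem b),
      forall x, (x \in mem b) = dom x && (blk x == b) & sz b = size (mem b)].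

Lemma members_ext (dom dom' : pred nat) (blk blk' : nat -> nat) nx pv hd sz :
  dom =1 dom' -> (forall x, dom x -> blk x = blk' x) ->
  members_ok dom blk nx pv hd sz -> members_ok dom' blk' nx pv hd sz.
Proof.
move=> ed eb [mem ok]; exists mem => b; have [? ? mb ?] := ok b; split=> // x.
by rewrite mb -ed; case dx: (dom x) => //=; rewrite eb.
Qed.

Lemma members_insert (dom : pred nat) blk nx pv hd sz s b q :
  ~~ dom s -> members_ok dom blk nx pv hd sz -> q = hd b ->
  members_ok (fun x => dom x || (x == s)) (upd blk s b) (upd nx s q)
    (if q != 0 then upd (upd pv s 0) q.-1 s.+1 else upd pv s 0)
    (upd hd b s.+1) (upd sz b (sz b).+1).
Proof.
move=> nds [mem ok] ->; exists (cons_at mem b s) => c.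
have ns d : s \notin mem d by have [_ _ -> _] := ok d; rewrite (negPf nds).
have [[l d] u memE szE] := ok c; rewrite /cons_at.
have d1 : dseg (upd nx s (hd b)) (upd pv s 0) 0 (hd c) (mem c) l 0.
  apply: dseg_ext d => // y my; rewrite upd_other //;
  by apply: contraNneq (ns c) => <-.
have eE x : c != b -> (x \in mem c) = (dom x || (x == s)) && (upd blk s b x == c).
  move=> neq; rewrite memE /upd; case: (eqVneq x s) => [->|_]; last by rewrite orbF.
  by rewrite (negPf nds) (eq_sym b) (negPf neq).
case: (eqVneq c b) => [ecb|neq]; last first.
  rewrite !upd_other //; split=> //; last by move=> x; apply: eE.
  exists l; case: ifP => // hb.
  (* The overwritten back link is that of the old head of list [b], which cannot occur in list [c],
     as a state has only one block. *)
  apply: dseg_ext d1 => // y my; rewrite [RHS]upd_other //.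
  have [[l' d'] _ memE' _] := ok b.
  have [xs' [e _]] := linked_list_nz (dseg_linked d') (elimN eqP hb).
  apply: contraNneq neq => ye; have : y \in mem b by rewrite ye e mem_head.
  by move: my; rewrite memE memE' => /andP[_ /eqP->] /andP[_ /eqP->].
subst c; rewrite !upd_same szE; split=> //.
- have e := dseg_head_nil d.
  case: ifPn e => [nz|/negPn/eqP z] /esym e.
    have [h0 hm d2] := dseg_set_head s.+1 u (negbT (etrans e (negbTE nz))) d1.
    exists l; rewrite /= upd_same; split=> //.
    by rewrite upd_other ?upd_same //; apply: contraNneq (ns b) => ->.
  exists s.+1; rewrite z in d1 e *; rewrite (eqP e) /= !upd_same; by split.
- by rewrite /= ns.
- move=> x; rewrite inE memE /upd; case: (eqVneq x s) => [->|_] /=; last by rewrite orbF.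
  by rewrite orbT eqxx.
Qed.

Lemma members_delete (dom : pred nat) blk nx pv hd sz s b p q :
  dom s -> members_ok dom blk nx pv hd sz -> b = blk s -> p = pv s -> q = nx s ->
  members_ok (fun x => dom x && (x != s)) blk
    (if p == 0 then nx else upd nx p.-1 q) (if q != 0 then upd pv q.-1 p else pv)
    (if p == 0 then upd hd b q else hd) (upd sz b (sz b).-1).
Proof.
move=> ds [mem ok] be pe qe.
exists (fun c => if c == b then rem s (mem b) else mem c) => c.
have [[l d] u memE szE] := ok b.
have ms : s \in mem b by rewrite memE ds be eqxx.
have [xs [ys exy]] : exists xs ys, mem b = xs ++ s :: ys.
  by case/splitPr: ms => xs ys; exists xs, ys.
have er : rem s (mem b) = xs ++ ys.
  rewrite rem_filter //; move: u; rewrite exy.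
  rewrite cat_uniq /= => /and3P[_ /norP[ns1 _] /andP[ns2 _]].
  rewrite filter_cat /= eqxx /=; congr (_ ++ _); apply/all_filterP/allP => y ym /=;
  by [apply: contraNneq ns1 => <- | apply: contraNneq ns2 => <-].
rewrite exy in d u; have [px qy d'] := dseg_remove u d pe qe; rewrite -exy in u.
case: (eqVneq c b) => [->|neq]; last first.
  have [[lc dc] uc memEc szEc] := ok c.
  rewrite upd_other //; split=> //; last first.
    move=> x; rewrite memEc; case: (eqVneq x s) => [->|]; last by rewrite andbT.
    by rewrite -be eq_sym (negPf neq) andbF.
  exists lc; have -> : (if p == 0 then upd hd b q else hd) c = hd c.
    by case: ifP; rewrite ?upd_other.
  have out y : y \in mem c -> y \in mem b -> False.
    rewrite memEc memE => /andP[_ /eqP e1] /andP[_ /eqP e2].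
    by rewrite -e1 e2 eqxx in neq.
  apply: dseg_ext dc => y yc.
    case: ifPn => // pn; rewrite upd_other //; apply/eqP=> e; apply: (out y) => //.
    by rewrite exy mem_cat e px.
  case: ifPn => // qn; rewrite upd_other //; apply/eqP=> e; apply: (out y) => //.
  by rewrite exy mem_cat inE e qy // !orbT.
split.
- exists (if q == 0 then p else l); rewrite er.
  have -> : (if p == 0 then upd hd b q else hd) b = if p == 0 then q else hd b.
    by case: ifP; rewrite ?upd_same.
  by move: d'; case: (q == 0).
- exact: rem_uniq.
- by move=> x; rewrite mem_rem_uniq // inE memE; case: (x == s); rewrite ?andbT ?andbF.
- by rewrite upd_same size_rem // szE.
Qed.

(** * Adjacency lists *)

Lemma build_successors_wp n m :
  (forall u, arrs m a_ahead u = 0) ->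
  (forall j, j < regs m v_m -> arrs m a_src j < n) ->
  wp build_successors m (fun t m' =>
    t <= 4 * regs m v_m + 4 /\
    exists adj, [/\ linked_lists (arrs m' a_anext) (arrs m' a_ahead) adj,
      forall u j, j \in adj u -> j < regs m v_m /\ arrs m a_src j = u &
      \sum_(0 <= u < n) size (adj u) <= regs m v_m]).
Proof.
move=> ah0 srcn; apply: wpfW => /=.
pose I (g : nat * (nat -> seq nat)) m' :=
  [/\ regs m' v_j = g.1, g.1 <= regs m v_m,
    linked_lists (arrs m' a_anext) (arrs m' a_ahead) g.2,
    forall u j, j \in g.2 u -> j < g.1 /\ arrs m a_src j = u &
    \sum_(0 <= u < n) size (g.2 u) = g.1].
apply: (wp_while (I := I) (phi := fun g => 4 * (regs m v_m - g.1)) (g0 := (0, fun=> [::]))).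
- by split=> //=; rewrite big1.
- move=> [i adj] m' [/= ij iM ll adjP adjS] [fr fa] /=.
  rewrite ij (fr v_m isT) => /= lt.
  apply: wpfW => /=; rewrite ij (fa a_src isT) /=.
  exists (i.+1, cons_at adj (arrs m a_src i) i); last by rewrite /=; lia.
  split=> //=.
  + apply: linked_lists_push ll => c; apply/negP => /adjP[]; lia.
  + move=> u j; rewrite /cons_at; case: eqP => [->|_]; last by move=> /adjP[]; split=> //; lia.
    rewrite inE => /predU1P[->//|/adjP[]]; split=> //; lia.
  + have := sum_upd (f := fun u => size (adj u))
      (g := fun u => size (cons_at adj (arrs m a_src i) i u)) (srcn i lt).
    rewrite /cons_at eqxx /= adjS => /(_ _)/wrap[]; last by lia.
    by move=> x /negPf->.
- move=> [i adj] m' t [/= ij iM ll adjP adjS] [fr fa].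
  rewrite -leqNgt ij (fr v_m isT) /= => le le2; split; first lia.
  exists adj; split=> //; last by lia.
  by move=> u j /adjP[]; split=> //; lia.
Qed.

Lemma build_dag_wp m :
  (forall d, arrs m a_dhead d = 0) ->
  let comp := arrs m a_comp in let src := arrs m a_src in
  let tgt := arrs m a_tgt in let M := regs m v_m in
  wp build_dag m (fun t m' =>
    t <= 8 * M + 4 /\
    exists preds, [/\ linked_lists (arrs m' a_dnext) (arrs m' a_dhead) preds,
      forall d, uniq (preds d),
      forall d j, (j \in preds d) =
        [&& j < M, comp (src j) != comp (tgt j) & comp (tgt j) == d] &
      forall j, j < M -> comp (src j) != comp (tgt j) ->
        arrs m' a_dsrc j = comp (src j)]).
Proof.
move=> dh0 comp src tgt M; apply: wpfW => /=.
pose I (g : nat * (nat -> seq nat)) m' :=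
  [/\ regs m' v_j = g.1 /\ g.1 <= M,
      linked_lists (arrs m' a_dnext) (arrs m' a_dhead) g.2,
      forall d, uniq (g.2 d),
      forall d j, (j \in g.2 d) =
        [&& j < g.1, comp (src j) != comp (tgt j) & comp (tgt j) == d] &
      forall j, j < g.1 -> comp (src j) != comp (tgt j) ->
        arrs m' a_dsrc j = comp (src j)].
apply: (wp_while (I := I) (phi := fun g => 8 * (M - g.1)) (g0 := (0, fun=> [::]))).
- by split=> //=; rewrite dh0.
- move=> [i preds] m' [[/= ij iM] ll up pP dP] [fr fa] /=.
  rewrite ij (fr v_m isT) => /= lt.
  apply: wpfW => /=; rewrite !ij (fa a_src isT) (fa a_tgt isT) (fa a_comp isT) /=.
  rewrite -/comp -/src -/tgt; case: ifPn => [neq|eq].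
    exists (i.+1, cons_at preds (comp (tgt i)) i); last by rewrite /=; lia.
    have ni c : i \notin preds c by rewrite pP ltnn.
    split=> //=.
    + exact: linked_lists_push ll.
    + by move=> d; rewrite /cons_at; case: ifP => //= _; rewrite ni up.
    + move=> d j; rewrite /cons_at ltnS leq_eqVlt (fun_if (fun s => j \in s)) inE pP.
      case: (eqVneq j i) => [->|_] /=; last by case: ifP.
      by rewrite neq eq_sym ltnn; case: eqP.
    + move=> j ltj neqj; case: (eqVneq j i) => [->//|nji]; apply: dP => //; lia.
  exists (i.+1, preds); last by rewrite /=; lia.
  split=> //=.
  + move=> d j; rewrite pP ltnS [j <= i]leq_eqVlt; case: (eqVneq j i) => [->|//] /=.
    by rewrite (negPf eq) ltnn.
  + move=> j ltj neqj; apply: dP => //; rewrite ltn_neqAle -ltnS ltj andbT.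
    by apply: contraNneq eq => <-.
- move=> [i preds] m' t [[/= ij iM] ll up pP dP] [fr fa].
  rewrite -leqNgt ij (fr v_m isT) /= -/M => le le2; split; first lia.
  have iME : i = M by lia.
  by exists preds; rewrite -iME.
Qed.

(** * Invariant of Tarjan's algorithm *)

(* [fs] lists the pending calls, the current one first: [(c, seg)] is the state [c]
   with the finished states above it, up to the next pending call, on the stack. *)
Fixpoint stk (fs : seq (nat * seq nat)) : seq nat :=
  if fs is (c, seg) :: fs' then stk fs' ++ c :: seg else [::].

Section Tarjan.

Variables (n M : nat) (src tgt anext ahead : nat -> nat) (R : nat -> nat -> Prop).
Hypothesis R_refl : forall x, R x x.
Hypothesis R_trans : forall x y z, R x y -> R y z -> R x z.

Definition top_reaches (fs : seq (nat * seq nat)) (w : nat) : Prop :=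
  if fs is (c, _) :: _ then R c w else True.

(** Only soundness is recorded: [low c] is the number of some stack state that [c] reaches, with no
    claim of minimality. A finished state reaches an older state [y] of the stack; the bound
    [low c <= num y] keeps [y] inside the segment when [low c = num c]. For an outer call all
    witnesses lie in its own part of the stack. *)
Fixpoint frames_ok (num low : nat -> nat) (fs : seq (nat * seq nat)) : Prop :=
  if fs is (c, seg) :: fs' then
    [/\ exists2 y, y \in stk fs & num y = low c /\ R c y,
        low c <= num c,
        forall x, x \in seg -> R c x /\
          exists2 y, y \in stk fs & [/\ num y < num x, low c <= num y & R x y],
        top_reaches fs' c
      & frames_ok num low fs']
  else True.

(** The ghost list [rem u] holds the transitions of [u] still to be traversed. It starts at
    [ahead u] as long as [u] is unvisited, so the sum of the sizes counts all untraversed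
    transitions, whether or not [ptr] is initialised. The class of component 0 is empty, since 0
    stands for no component. *)
Record tarjan_inv (num low ptr par ts comp chead cnext : nat -> nat)
    (cur cnt tp nc : nat) (fs : seq (nat * seq nat)) (rem cls : nat -> seq nat)
    : Prop := TarjanInv {
  ti_cur : linked_list par cur [seq f.1 | f <- fs];
  ti_tp : tp = size (stk fs);
  ti_ts : forall i, i < size (stk fs) -> ts i = nth 0 (stk fs) i;
  ti_sorted : pairwise ltn [seq num x | x <- stk fs];
  ti_cnt : forall x, num x <= cnt;
  ti_stk : forall x, (x \in stk fs) = (num x != 0) && (comp x == 0);
  ti_new : forall x, num x = 0 -> comp x = 0;
  ti_dom : forall x, num x != 0 -> x < n;
  ti_rem : forall u, linked_list anext (if num u == 0 then ahead u else ptr u) (rem u);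
  ti_remP : forall u j, j \in rem u -> j < M /\ src j = u;
  ti_frames : frames_ok num low fs;
  ti_nc : forall x, comp x <= nc;
  ti_cls : linked_lists cnext chead cls;
  ti_uniq : forall c, uniq (cls c);
  ti_clsP : forall c x, (x \in cls c) = (comp x == c) && (c != 0);
  ti_conn : forall x y, comp x = comp y -> comp x != 0 -> R x y
}.

Lemma frames_ext num low num' low' fs :
  {in stk fs, num =1 num'} -> {in stk fs, low =1 low'} ->
  frames_ok num low fs -> frames_ok num' low' fs.
Proof.
elim: fs => //= -[c seg] fs IH en el /= [[y sy [ey Ry]] lc segP tr ok].
have sc : c \in stk fs ++ c :: seg by rewrite mem_cat mem_head orbT.
split=> //.
- by exists y; rewrite // -en // -el // ey.
- by rewrite -en // -el.
- move=> x sx; have [Rx [z sz [lt le Rz]]] := segP x sx; split=> //.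
  exists z => //; rewrite -!en // -?el //.
  by rewrite mem_cat inE sx !orbT.
- apply: IH ok => z sz; [apply: en|apply: el]; by rewrite mem_cat sz.
Qed.

Lemma stk_num num c seg fs :
  pairwise ltn [seq num x | x <- stk ((c, seg) :: fs)] ->
  [/\ forall x, x \in stk fs -> num x < num c,
      forall x, x \in seg -> num c < num x &
      forall x y, x \in stk fs -> y \in seg -> num x < num y].
Proof.
rewrite /= map_cat pairwise_cat /= => /and3P[/allrelP a1 _ /andP[/allP a2 _]].
split=> [x sx|x sx|x y sx sy].
- by apply: a1; rewrite ?map_f ?mem_head.
- by apply: a2; rewrite map_f.
- by apply: a1; rewrite ?map_f // inE map_f ?orbT.
Qed.

Lemma stk_uniq num fs : pairwise ltn [seq num x | x <- stk fs] -> uniq (stk fs).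
Proof.
move=> s; apply: (@map_uniq _ _ num); apply: (@pairwise_uniq _ ltn) => //.
exact: ltnn.
Qed.

Section Steps.

Variables (num low ptr par ts comp chead cnext : nat -> nat) (cur cnt tp nc : nat).
Variables (rem cls : nat -> seq nat).

Lemma tarjan_inv_visit fs w :
  tarjan_inv num low ptr par ts comp chead cnext cur cnt tp nc fs rem cls ->
  num w = 0 -> w < n -> top_reaches fs w ->
  tarjan_inv (upd num w cnt.+1) (upd low w cnt.+1) (upd ptr w (ahead w))
    (upd par w cur) (upd ts tp w) comp chead cnext w.+1 cnt.+1 tp.+1 nc
    ((w, [::]) :: fs) rem cls.
Proof.
move=> [tcur ttp tts tsorted tcnt tstk tnew tdom trem tremP tframes tnc tcls tuniq tclsP tconn].
move=> w0 wn top.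
have nsw x : x \in stk fs -> x != w.
  by rewrite tstk; apply: contraTneq => ->; rewrite w0.
have cw : comp w = 0 by apply: tnew.
have nfw x : x \in [seq f.1 | f <- fs] -> x \in stk fs.
  elim: (fs) => //= -[c seg] fs' IH; rewrite inE mem_cat /= => /predU1P[->|/IH->//].
  by rewrite mem_head orbT.
split=> //=.
- split=> //; rewrite upd_same.
  by apply: linked_list_ext tcur => x /nfw/nsw sx; rewrite upd_other.
- by rewrite size_cat ttp addn1.
- move=> i; rewrite size_cat addn1 ltnS nth_cat ttp leq_eqVlt /upd.
  case: (eqVneq i (size _)) => [->|ni] /=; first by rewrite ltnn subnn.
  by move=> lt; rewrite lt tts.
- have e x : x \in stk fs -> upd num w cnt.+1 x = num x.
    by move=> /nsw sx; rewrite upd_other.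
  rewrite map_cat pairwise_cat /= andbT; apply/andP; split.
    apply/allrelP => x y /mapP[z sz ->]; rewrite inE => /eqP->.
    by rewrite e // upd_same; apply: tcnt.
  by move/eq_in_map: e => ->.
- by move=> x; rewrite /upd; case: ifP => // _; apply: leqW.
- move=> x; rewrite mem_cat inE tstk /upd; case: (eqVneq x w) => [->|_].
    by rewrite cw orbT.
  by rewrite orbF.
- by move=> x; rewrite /upd; case: ifP => // _; apply: tnew.
- by move=> x; rewrite /upd; case: (eqVneq x w) => [->//|_]; apply: tdom.
- move=> u; have := trem u; rewrite /upd; case: (eqVneq u w) => [->|//].
  by rewrite w0.
- split=> //.
  + by exists w; rewrite ?mem_cat ?mem_head ?orbT // !upd_same.
  + by rewrite !upd_same.
  + by apply: frames_ext tframes => x /nsw sx; rewrite upd_other.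
Qed.

Lemma tarjan_inv_edge fs u j js :
  tarjan_inv num low ptr par ts comp chead cnext cur cnt tp nc fs rem cls ->
  num u != 0 -> rem u = j :: js ->
  tarjan_inv num low (upd ptr u (anext j)) par ts comp chead cnext cur cnt tp nc
    fs (fun v => if v == u then js else rem v) cls.
Proof.
move=> [tcur ttp tts tsorted tcnt tstk tnew tdom trem tremP tframes tnc tcls tuniq tclsP tconn].
move=> nu ru; split=> //.
- move=> v; rewrite /upd; have := trem v; case: (eqVneq v u) => [->|//].
  by rewrite (negPf nu) ru => -[_].
- move=> v i; case: (eqVneq v u) => [->|_]; last exact: tremP.
  by move=> ji; apply: tremP; rewrite ru inE ji orbT.
Qed.

(** Lowering [low u] only weakens the clause on the finished states of [u]; the outer calls do not
    mention [low u]. *)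
Lemma tarjan_inv_low fs u seg w :
  tarjan_inv num low ptr par ts comp chead cnext cur cnt tp nc
    ((u, seg) :: fs) rem cls ->
  num w != 0 -> comp w = 0 -> R u w -> num w < low u ->
  tarjan_inv num (upd low u (num w)) ptr par ts comp chead cnext cur cnt tp nc
    ((u, seg) :: fs) rem cls.
Proof.
move=> [tcur ttp tts tsorted tcnt tstk tnew tdom trem tremP tframes tnc tcls tuniq tclsP tconn].
move=> nw cw Rw lt; split=> //=.
have [ltu _ _] := stk_num tsorted.
have /= [[y sy [ey Ry]] lc segP tr ok] := tframes.
split=> //.
- by exists w; rewrite ?upd_same //; rewrite -[_ ++ _]/(stk ((u, seg) :: fs)) tstk nw cw.
- by rewrite upd_same; lia.
- move=> x sx; have [Rx [z sz [lt1 le Rz]]] := segP x sx; split=> //.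
  by exists z => //; split=> //; rewrite upd_same; lia.
- apply: frames_ext ok => // x sx; rewrite upd_other //.
  by apply: contraTneq (ltu x sx) => ->; rewrite ltnn.
Qed.

(** The call of [u] ends without closing a component: [u] and its segment become finished states of
    the caller [c], and the stack stays the same. *)
Lemma tarjan_inv_return fs u seg c seg' :
  tarjan_inv num low ptr par ts comp chead cnext cur cnt tp nc
    ((u, seg) :: (c, seg') :: fs) rem cls ->
  low u != num u ->
  tarjan_inv num (if low u < low c then upd low c (low u) else low) ptr par ts
    comp chead cnext (par u) cnt tp nc ((c, seg' ++ u :: seg) :: fs) rem cls.
Proof.
move=> [tcur ttp tts tsorted tcnt tstk tnew tdom trem tremP tframes tnc tcls tuniq tclsP tconn] neq.
have stkE : stk ((c, seg' ++ u :: seg) :: fs) = stk ((u, seg) :: (c, seg') :: fs).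
  by rewrite /= -catA.
have [ltu gtu lt1] := stk_num tsorted.
have sorted' : pairwise ltn [seq num x | x <- stk ((c, seg') :: fs)].
  by move: tsorted; rewrite /= map_cat pairwise_cat => /and3P[].
have [ltc gtc _] := stk_num sorted'.
have fsnc x : x \in stk fs -> x != c.
  by move=> sx; apply: contraTneq (ltc x sx) => ->; rewrite ltnn.
set low' := if _ then _ else _.
have low'c : low' c <= low u /\ low' c <= low c.
  by rewrite /low'; case: ifP; rewrite ?upd_same; lia.
have /= [[y sy [ey Ry]] lu segP Rcu [[y' sy' [ey' Ry']] lc segP' tr ok]] := tframes.
have low'o x : x \in stk fs -> low' x = low x.
  by move=> /fsnc sx; rewrite /low'; case: ifP; rewrite ?upd_other.
split; rewrite ?stkE //.
- by case: tcur.
- split=> //; rewrite ?stkE.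
  + case lt: (low u < low c); rewrite /low' lt.
      by exists y; rewrite ?upd_same //; split=> //; apply: R_trans Ry.
    by exists y' => //; rewrite [stk _]/= mem_cat sy'.
  + lia.
  + move=> x; rewrite mem_cat inE => /or3P[sx|/eqP->|sx].
    * have [Rx [z sz [? ? Rz]]] := segP' x sx; split=> //; exists z.
        by rewrite [stk _]/= mem_cat sz.
      split=> //; lia.
    (* For [u] itself the older state is the witness of [low u]: it is strictly older because
       [low u] differs from [num u]. *)
    * split=> //; exists y => //; split=> //; lia.
    * have [Rx [z sz [? ? Rz]]] := segP x sx; split; first exact: R_trans Rx.
      exists z => //; split=> //; lia.
  + by apply: frames_ext ok => // x sx; rewrite low'o.
Qed.

(** From a state of the segment one reaches a stack state with a smaller number, at least
    [low u = num u], hence again in the segment. Descent on [num] ends at [u], and [u] reaches its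
    whole segment. *)
Lemma component_root fs u seg :
  tarjan_inv num low ptr par ts comp chead cnext cur cnt tp nc
    ((u, seg) :: fs) rem cls ->
  low u = num u -> forall x y, x \in u :: seg -> y \in u :: seg -> R x y.
Proof.
move=> [tcur ttp tts tsorted tcnt tstk tnew tdom trem tremP tframes tnc tcls tuniq tclsP tconn] eq.
have [ltu gtu lt1] := stk_num tsorted.
have /= [_ _ segP _ _] := tframes.
have down x : x \in u :: seg -> R x u.
  have [k] := ubnP (num x); elim: k x => // k IH x ltk.
  rewrite inE => /predU1P[->//|sx].
  have [_ [y sy [lt le Rxy]]] := segP x sx; apply: (R_trans Rxy); apply: IH; first lia.
  by move: sy; rewrite mem_cat => /orP[/ltu|//]; lia.
move=> x y sx; rewrite inE => /predU1P[->|sy]; first exact: down.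
by apply: R_trans (down x sx) _; case: (segP y sy).
Qed.

(** In the outermost call no stack state is older than [u], so [low u], being the number of one of
    them, cannot be below [num u]. *)
Lemma low_root u seg :
  tarjan_inv num low ptr par ts comp chead cnext cur cnt tp nc
    [:: (u, seg)] rem cls -> low u = num u.
Proof.
move=> ti; have [_ gtu _] := stk_num (ti_sorted ti).
have /= [[y sy [ey _]] le _ _ _] := ti_frames ti.
by move: sy; rewrite inE => /predU1P[yu|/gtu]; [rewrite -yu in ey *|]; lia.
Qed.

Lemma tarjan_inv_pop fs u seg chead' cnext' comp' cls' :
  tarjan_inv num low ptr par ts comp chead cnext cur cnt tp nc
    ((u, seg) :: fs) rem cls ->
  low u = num u ->
  comp' =1 (fun x => if x \in u :: seg then nc.+1 else comp x) ->
  linked_lists cnext' chead' cls' ->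
  cls' =1 (fun c => if c == nc.+1 then u :: seg else cls c) ->
  tarjan_inv num low ptr par ts comp' chead' cnext' (par u) cnt (size (stk fs)) nc.+1
    fs rem cls'.
Proof.
move=> ti eq comp'E ll' cls'E; have conn := component_root ti eq; move: ti.
move=> [tcur ttp tts tsorted tcnt tstk tnew tdom trem tremP tframes tnc tcls tuniq tclsP tconn].
have [ltu gtu lt1] := stk_num tsorted.
have uq := stk_uniq tsorted.
have comp0 x : x \in u :: seg -> (num x != 0) && (comp x == 0).
  by move=> sx; rewrite -tstk /= mem_cat sx orbT.
have neqc x : (comp x == nc.+1) = false by have := tnc x; lia.
have /= [_ _ _ _ ok] := tframes.
split=> //.
- by case: tcur.
- move=> i lti; rewrite tts /= ?size_cat ?nth_cat ?lti //; lia.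
- by move: tsorted; rewrite /= map_cat pairwise_cat => /and3P[].
- move=> x; have := tstk x; rewrite /= mem_cat comp'E.
  case: ifP => [sx _|_ <-]; last by rewrite orbF.
  move: uq; rewrite /= cat_uniq => /and3P[_ /hasPn /(_ x sx) /negPf-> _].
  by rewrite andbF.
- move=> x x0; rewrite comp'E; case: ifP => [/comp0|_]; last exact: tnew.
  by rewrite x0.
- by move=> x; rewrite comp'E; case: ifP => // _; apply: leqW.
- move=> c; rewrite cls'E; case: eqP => // _.
  by move: uq; rewrite /= cat_uniq => /and3P[].
- move=> c x; rewrite cls'E comp'E; case: (eqVneq c nc.+1) => [->|neq].
    by case: ifP => sx; rewrite ?eqxx // neqc.
  rewrite tclsP; case: ifP => // /comp0 /andP[_ /eqP->].
  by rewrite [nc.+1 == c]eq_sym (negPf neq); case: (c).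
- move=> x y; rewrite !comp'E; case: ifP => sx; case: ifP => sy.
  + by move=> *; apply: conn.
  + by move/esym/eqP; rewrite neqc.
  + by move/eqP; rewrite neqc.
  + exact: tconn.
Qed.

End Steps.
End Tarjan.

Lemma wp_assign l e m (Q : nat -> memory -> Prop) :
  Q 1 (store m l (eval_exp m e)) -> wp (Assign l e) m Q.
Proof. by move=> q; apply: wpfW. Qed.

Lemma wp_if b c1 c2 m (Q : nat -> memory -> Prop) :
  (eval_test m b -> wp c1 m (fun t => Q t.+1)) ->
  (~~ eval_test m b -> wp c2 m (fun t => Q t.+1)) ->
  wp (If b c1 c2) m Q.
Proof.
move=> w1 w2; have [b_m|b_m] := boolP (eval_test m b).
  have [t [m' [e q]]] := w1 b_m; exists t.+1, m'; split=> //; exact: ExecIfTrue.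
have [t [m' [e q]]] := w2 b_m; exists t.+1, m'; split=> //; exact: ExecIfFalse.
Qed.

(** * Execution and running time of Tarjan's algorithm *)

Section Tarjan.

Variables (n M : nat) (src tgt anext ahead : nat -> nat) (R : nat -> nat -> Prop).
Hypothesis R_refl : forall x, R x x.
Hypothesis R_trans : forall x y z, R x y -> R y z -> R x z.
Hypothesis R_edge : forall j, j < M -> R (src j) (tgt j).
Hypothesis tgt_lt : forall j, j < M -> tgt j < n.

Definition tarjan_ok (fs : seq (nat * seq nat)) rem cls (m : memory) : Prop :=
  tarjan_inv n M src anext ahead R (arrs m a_num) (arrs m a_low) (arrs m a_ptr)
    (arrs m a_par) (arrs m a_tstack) (arrs m a_comp) (arrs m a_chead)
    (arrs m a_cnext) (regs m v_cur) (regs m v_cnt) (regs m v_tp) (regs m v_nc)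
    fs rem cls.

Lemma tarjan_visit_wp w fs rem cls m :
  w = v_i \/ w = v_w -> arrs m a_ahead = ahead ->
  tarjan_ok fs rem cls m -> arrs m a_num (regs m w) = 0 -> regs m w < n ->
  top_reaches R fs (regs m w) ->
  wp (tarjan_visit w) m (fun t m' =>
    t = 8 /\ tarjan_ok ((regs m w, [::]) :: fs) rem cls m' /\
    arrs m' a_num = upd (arrs m a_num) (regs m w) (regs m v_cnt).+1).
Proof.
move=> ww ah ok nw wn top.
have := tarjan_inv_visit R_refl ok nw wn top.
by case: ww nw wn top => -> nw wn top ok'; apply: wpfW => /=; rewrite ah.
Qed.

(** An untraversed transition pays 17. The 40 of an unvisited state are released by its visit, which
    deposits 20 for the end of its call and 8 for its removal from the stack. *)
Definition tarjan_potential (fs : seq (nat * seq nat)) (rem : nat -> seq nat) num :=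
  17 * \sum_(0 <= u < n) size (rem u) + 40 * \sum_(0 <= u < n) (num u == 0)
  + 20 * size fs + 8 * size (stk fs).

(** Once [u] has left the stack, [v_cur] no longer matches the pending calls. The invariant is
    therefore claimed for the memory after the assignment of [v_cur] that follows in the program. *)
Lemma tarjan_pop_wp fs u seg rem cls m :
  tarjan_ok ((u, seg) :: fs) rem cls m -> regs m v_u = u ->
  arrs m a_low u = arrs m a_num u ->
  wp tarjan_pop_component m (fun t m' =>
    t <= 6 * size (u :: seg) + 2 /\
    exists cls', tarjan_ok fs rem cls'
      (store m' (Reg v_cur) (arrs m a_par u))).
Proof.
move=> ok mu eq; apply: wpfW => /=; set m0 := Memory _ _.
have comp0 x : x \in u :: seg -> arrs m a_comp x = 0.
  move=> sx; have := ti_stk ok x.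
  by rewrite /= mem_cat sx orbT => /esym/andP[_ /eqP].
have uq : uniq (stk fs ++ u :: seg) := stk_uniq (ti_sorted ok).
pose nc1 := (regs m v_nc).+1.
pose I (g : seq nat * seq nat) (m' : memory) :=
  [/\ u :: seg = g.1 ++ g.2,
      regs m' v_tp = size (stk fs) + size g.1,
      forall x, arrs m' a_comp x = if x \in g.2 then nc1 else arrs m a_comp x &
      linked_lists (arrs m' a_cnext) (arrs m' a_chead)
        (fun c => if c == nc1 then g.2 else cls c)].
apply: (wp_while (I := I) (phi := fun g => 6 * size g.1) (g0 := (u :: seg, [::]))).
- split=> //=; first by rewrite cats0.
    by rewrite (ti_tp ok) size_cat.
  move=> c; case: eqP => [->|_]; last exact: ti_cls ok c.
  (* The new component number exceeds all those in use, so its class is still empty. *)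
  suff : cls nc1 = [::] by move=> <-; apply: ti_cls ok nc1.
  case E: (cls nc1) => [//|x s]; have := ti_clsP ok nc1 x.
  by rewrite E mem_head => /esym/andP[/eqP cx _]; have := ti_nc ok x; rewrite cx ltnn.
- move=> [pre suf] m' [/= us tp co ll] [fr fa].
  rewrite /= (fr v_u isT) /= mu co; case: ifP => // nsu /eqP cu.
  case/lastP: pre us tp => [/= us|pre w us tp].
    by rewrite -us mem_head in nsu.
  apply: wpfW => /=; exists (pre, w :: suf); last by rewrite /= size_rcons; lia.
  rewrite (fr v_nc isT) /= tp size_rcons addnS /=.
  have -> : arrs m' a_tstack (size (stk fs) + size pre) = w.
    have -> := fa a_tstack isT; rewrite /= (ti_ts ok) /= us cat_rcons.
      rewrite nth_cat ltnNge leq_addr /= addKn nth_cat ltnn subnn //.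
    by rewrite !size_cat /=; lia.
  have ws : w \notin suf.
    move: uq; rewrite us cat_uniq => /and3P[_ _].
    by rewrite cat_rcons cat_uniq /= => /and3P[_ _ /andP[]].
  have wu : w \in u :: seg by rewrite us mem_cat mem_rcons mem_head.
  rewrite /I /=; split=> //.
  + by rewrite us cat_rcons.
  + by move=> x; rewrite inE; case: (eqVneq x w).
  + apply: (@linked_lists_eq _ _ (cons_at (fun c => if c == nc1 then suf else cls c) nc1 w)).
      by move=> c; rewrite /cons_at; case: eqP.
    apply: linked_lists_push ll => c; case: eqP => // _.
    by rewrite (ti_clsP ok) comp0 // eq_sym; case: (c).
- move=> [pre suf] m' t [/= us tp co ll] [fr fa].
  rewrite /= (fr v_u isT) /= mu co => cu le; split; first by move: le; rewrite /=; lia.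
  have usuf : u \in suf.
    by move: cu; case: ifP => //; rewrite comp0 // mem_head.
  (* The loop stops when [u] has a component. As [u] is the lowest state of its segment, everything
     above it has been popped by then. *)
  have pre0 : pre = [::].
    case: pre us {tp I le} => //= x pre [ux us].
    by move: uq; rewrite cat_uniq /= => /and3P[_ _ /andP[/negP[]]]; rewrite us mem_cat usuf orbT.
  subst pre; rewrite /= in us tp co ll.
  exists (fun c => if c == nc1 then suf else cls c).
  rewrite addn0 in tp; rewrite -us in co ll.
  have := tarjan_inv_pop R_refl R_trans ok eq (comp' := arrs m' a_comp) co ll.
  move=> /(_ (fun=> erefl)); rewrite -us /tarjan_ok /= tp.
  rewrite (fa a_num isT) (fa a_low isT) (fa a_ptr isT) (fa a_par isT) (fa a_tstack isT).
  by rewrite (fr v_cnt isT) (fr v_nc isT).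
Qed.

Definition tarjan_step : cmd := (
  v_u <~ v_cur.-1 ;;
  v_e <~ a_ptr!!v_u ;;
  IF v_e != 0 THEN
    a_ptr!!v_u <~ a_anext!!(v_e.-1) ;;
    v_w <~ a_tgt!!(v_e.-1) ;;
    IF a_num!!v_w == 0 THEN
      tarjan_visit v_w
    ELSE
      IF a_comp!!v_w == 0 THEN
        IF a_num!!v_w < a_low!!v_u THEN a_low!!v_u <~ a_num!!v_w FI
      FI
    FI
  ELSE
    IF a_low!!v_u == a_num!!v_u THEN tarjan_pop_component FI ;;
    v_cur <~ a_par!!v_u ;;
    IF v_cur != 0 THEN
      IF a_low!!v_u < a_low!!(v_cur.-1) THEN
        a_low!!(v_cur.-1) <~ a_low!!v_u
      FI
    FI
  FI)%cmd.

Lemma tarjan_step_wp fs rem cls m :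
  arrs m a_ahead = ahead -> arrs m a_anext = anext -> arrs m a_tgt = tgt ->
  tarjan_ok fs rem cls m -> regs m v_cur <> 0 ->
  wp tarjan_step m (fun t m' => exists fs' rem' cls',
    [/\ tarjan_ok fs' rem' cls' m',
        t.+1 + tarjan_potential fs' rem' (arrs m' a_num)
          <= tarjan_potential fs rem (arrs m a_num) &
        forall x, arrs m a_num x != 0 -> arrs m' a_num x != 0]).
Proof.
move=> ah an tg ok cur0.
case: fs ok => [|[u seg] fs] ok; first by case: cur0; have := ti_cur ok.
have [cu cpar] : regs m v_cur = u.+1 /\
    linked_list (arrs m a_par) (arrs m a_par u) [seq f.1 | f <- fs] := ti_cur ok.
have nu : (arrs m a_num u != 0) && (arrs m a_comp u == 0).
  by rewrite -(ti_stk ok) /= mem_cat mem_head orbT.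
have un : u < n by apply: ti_dom ok _ _; case/andP: nu.
have := ti_rem ok u; case/andP: nu => nu comp_u; rewrite (negPf nu) => llu.
apply: wp_seq; apply: wp_assign; apply: wp_seq; apply: wp_assign.
apply: wp_if => /=; rewrite cu /=.
  move/eqP => e0; have [js [ru _]] := linked_list_nz llu e0.
  set j := (arrs m a_ptr u).-1 in ru; have jM : j < M /\ src j = u.
    by apply: (ti_remP ok); rewrite ru mem_head.
  have ok1 := tarjan_inv_edge ok nu ru.
  set rem1 := (fun v => _) in ok1.
  have remS : \sum_(0 <= v < n) size (rem1 v) + 1 = \sum_(0 <= v < n) size (rem v).
    have := sum_upd (f := fun v => size (rem v)) (g := fun v => size (rem1 v)) un.
    by rewrite /rem1 eqxx ru /= => /(_ (fun x xu => ltac:(by rewrite (negPf xu)))); lia.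
  have wn : tgt j < n by apply: tgt_lt; case: jM.
  have Ruw : R u (tgt j) by case: jM => jM <-; apply: R_edge.
  apply: wp_seq; apply: wp_assign; apply: wp_seq; apply: wp_assign; rewrite /= tg an -/j.
  apply: wp_if => /=.
    move/eqP => w0; apply: wp_conseq.
      apply: (@tarjan_visit_wp v_w ((u, seg) :: fs) rem1 cls) => //=; first by right.
    move=> t m' /= [-> [ok' num']].
    exists ((tgt j, [::]) :: (u, seg) :: fs), rem1, cls; split=> //; last first.
      by move=> x; rewrite num' /upd; case: ifP.
    have := sum_upd (f := fun v => arrs m a_num v == 0 : nat)
      (g := fun v => arrs m' a_num v == 0 : nat) wn.
    rewrite num' upd_same w0 eqxx /= => /(_ (fun x xu => ltac:(by rewrite upd_other))).
    by rewrite /tarjan_potential /= !size_cat /=; lia.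
  move=> w0; apply: wpfW => /=.
  have pot t : t <= 9 -> t.+1 + tarjan_potential ((u, seg) :: fs) rem1 (arrs m a_num)
      <= tarjan_potential ((u, seg) :: fs) rem (arrs m a_num).
    by rewrite /tarjan_potential; lia.
  case: eqP => cw; last first.
    by exists ((u, seg) :: fs), rem1, cls; split; [exact: ok1|apply: pot|].
  case: ifP => lt; last first.
    by exists ((u, seg) :: fs), rem1, cls; split; [exact: ok1|apply: pot|].
  exists ((u, seg) :: fs), rem1, cls; split=> //; last by apply: pot.
  exact: tarjan_inv_low ok1 w0 cw Ruw lt.
move=> /negPn/eqP e0; apply: wp_seq; apply: wp_if => /=.
  move=> /eqP eq.
  set m2 := Memory _ _.
  apply: wp_conseq.
    exact: wp_frame (@tarjan_pop_wp fs u seg rem cls m2 ok erefl eq).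
  move=> t m' [[le [cls' ok']] [fr fa]]; apply: wpfW => /=.
  rewrite (fr v_u isT) /= (fa a_par isT) (fa a_low isT) (fa a_num isT) /=.
  have pot s : s <= t + 9 -> s.+1 + tarjan_potential fs rem (arrs m a_num)
      <= tarjan_potential ((u, seg) :: fs) rem (arrs m a_num).
    by rewrite /tarjan_potential /= size_cat /=; move: le; rewrite /=; lia.
  case: ifPn => par0.
    (* After a pop this test fails: [low u = num u] is above [num c], which is at least [low c]. *)
    case: ifPn => lt.
      case: (fs) cpar (ok) lt => [/= p0|[c seg'] fs' [-> _] okc] /=; first by rewrite p0 in par0.
      have [ltu _ _] := stk_num (ti_sorted okc).
      have cs : c \in stk ((c, seg') :: fs') by rewrite /= mem_cat mem_head orbT.
      have [_ _ _ _ [_ lc _ _ _]] := ti_frames okc.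
      by have := ltu c cs; lia.
    by exists fs, rem, cls'; split; [exact: ok'|apply: pot; lia|].
  by exists fs, rem, cls'; split; [exact: ok'|apply: pot; lia|].
move=> neq; apply: wpfW => /=.
case: fs ok cpar => [|[c seg'] fs] ok cpar.
  (* A call without a caller always closes a component. *)
  by case/eqP: neq; apply: low_root ok.
have ok' := tarjan_inv_return R_trans ok neq; have [parE _] := cpar.
apply: wpfW => /=; rewrite parE /=.
have pot s : s <= 9 -> s.+1 +
    tarjan_potential ((c, seg' ++ u :: seg) :: fs) rem (arrs m a_num)
      <= tarjan_potential ((u, seg) :: (c, seg') :: fs) rem (arrs m a_num).
  by rewrite /tarjan_potential /= !size_cat /= !size_cat /=; lia.
rewrite parE in ok'.
by case: ifPn ok' => lt ok'; exists ((c, seg' ++ u :: seg) :: fs), rem, cls; split;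
  first [exact: ok' | by apply: pot | by []].
Qed.

(** The time bound is the initial potential: 40 for each unvisited state, 20 for each iteration of
    the outer loop and 17 for each transition. *)
Definition tarjan_post (m m' : memory) (t : nat) : Prop :=
  t <= 60 * n + 17 * M + 2 /\
  exists cls,
  [/\ linked_lists (arrs m' a_cnext) (arrs m' a_chead) cls,
      forall c, uniq (cls c),
      forall c x, c != 0 -> (x \in cls c) = (x < n) && (arrs m' a_comp x == c),
      forall x, x < n -> arrs m' a_comp x != 0 &
      forall x y, x < n -> arrs m' a_comp x = arrs m' a_comp y -> R x y].

Lemma tarjan_wp adj m :
  regs m v_n = n -> regs m v_cur = 0 -> regs m v_tp = 0 ->
  (forall x, arrs m a_num x = 0) -> (forall x, arrs m a_comp x = 0) ->
  (forall c, arrs m a_chead c = 0) ->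
  arrs m a_ahead = ahead -> arrs m a_anext = anext -> arrs m a_tgt = tgt ->
  linked_lists anext ahead adj ->
  (forall u j, j \in adj u -> j < M /\ src j = u) ->
  \sum_(0 <= u < n) size (adj u) <= M ->
  wp tarjan m (fun t m' => tarjan_post m m' t).
Proof.
move=> mn cur0 tp0 num0 comp0 ch0 ah an tg ll adjP adjS.
have ok0 : tarjan_ok [::] adj (fun=> [::]) m.
  split=> //=.
  - by move=> x; rewrite num0.
  - by move=> x; rewrite num0.
  - by move=> x; rewrite num0.
  - by move=> u; rewrite num0; apply: ll.
  - by move=> x; rewrite comp0.
  - by move=> c x; rewrite comp0 in_nil eq_sym; case: eqP.
  - by move=> x y _; rewrite comp0.
apply: wpfW => /=.
(* The array [num] is part of the ghost state because the potential may depend on the ghost state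
   only. *)
pose I (g : nat * (nat -> seq nat) * (nat -> seq nat) * (nat -> nat)) m' :=
  [/\ regs m' v_i = g.1.1.1 /\ g.1.1.1 <= n, arrs m' a_num = g.2,
      tarjan_ok [::] g.1.1.2 g.1.2 m' &
      forall x, x < g.1.1.1 -> arrs m' a_num x != 0].
apply: (wp_while (I := I)
  (phi := fun g => 20 * (n - g.1.1.1) + tarjan_potential [::] g.1.1.2 g.2)
  (g0 := (0, adj, fun=> [::], arrs m a_num))).
- by split.
- move=> [[[i rem] cls] num] m' [/= [mi _] mnum ok vis] [fr fa].
  rewrite /= mi (fr v_n isT) /= mn => lti.
  have curE : regs m' v_cur = 0 := ti_cur ok.
  apply: wp_seq; apply: wp_if => /=; rewrite mi => num_i; last first.
    apply: wpfW; apply: wpfW; rewrite /= mi; exists (i.+1, rem, cls, num); last by rewrite /=; lia.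
    split=> //=.
    by move=> x; rewrite ltnS leq_eqVlt => /predU1P[->|/vis].
  apply: wp_seq; apply: wp_assign; set m1 := store _ _ _.
  have ok1 : tarjan_ok [::] rem cls m1.
    by rewrite /tarjan_ok /= -curE; exact: ok.
  apply: wp_seq; apply: wp_conseq.
    apply: wp_frame.
    by apply: tarjan_visit_wp ok1 _ _ _; rewrite /= ?mi ?(fa a_ahead isT) //;
      [left|apply/eqP].
  rewrite [regs m1 _]/= mi => t m2 [[-> [ok2 num2]] [fr2 fa2]].
  pose J (g : seq (nat * seq nat) * (nat -> seq nat) * (nat -> seq nat) * (nat -> nat))
      m' := [/\ arrs m' a_num = g.2, tarjan_ok g.1.1.1 g.1.1.2 g.1.2 m' &
      forall x, arrs m2 a_num x != 0 -> arrs m' a_num x != 0].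
  apply: (wp_while (I := J)
    (phi := fun g => tarjan_potential g.1.1.1 g.1.1.2 g.2)
    (g0 := ([:: (i, [::])], rem, cls, arrs m2 a_num))) => //.
    move=> [[[fs r] cl] nm] m3 [/= nm3 ok3 mono] [fr3 fa3] /= cur3.
    apply: wp_conseq.
      apply: tarjan_step_wp ok3 _; last by apply/eqP.
      - by rewrite (fa3 a_ahead isT) (fa2 a_ahead isT) /= (fa a_ahead isT).
      - by rewrite (fa3 a_anext isT) (fa2 a_anext isT) /= (fa a_anext isT).
      - by rewrite (fa3 a_tgt isT) (fa2 a_tgt isT) /= (fa a_tgt isT).
    move=> t' m4 [fs4 [r4 [cl4 [ok4 le4 mono4]]]].
    exists (fs4, r4, cl4, arrs m4 a_num); last by rewrite /= -nm3.
    by split=> //= x x0; apply/mono4/mono.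
  move=> [[[fs r] cl] nm] m3 t' [/= nm3 ok3 mono] [fr3 fa3] /negPn/eqP cur3 /= le.
  apply: wpfW => /=.
  have fs0 : fs = [::].
    by have := ti_cur ok3; rewrite cur3; case: (fs) => // f fs' [].
  subst fs; rewrite (fr3 v_i isT) (fr2 v_i isT) /= mi.
  have num1E : arrs m1 a_num = num by rewrite /= mnum.
  exists (i.+1, r, cl, nm).
    split=> //= x; rewrite ltnS leq_eqVlt => ltx; apply: mono.
    rewrite num2 /upd; case: eqP ltx => //= _ /vis; by rewrite mnum.
  have ni : num i = 0 by apply/eqP; rewrite -mnum.
  have := sum_upd (f := fun v => num v == 0 : nat)
      (g := fun v => arrs m2 a_num v == 0 : nat) lti.
  rewrite num2 num1E upd_same ni /= => /(_ (fun x xu => ltac:(by rewrite upd_other))).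
  move: le; rewrite num2 num1E /tarjan_potential /=; lia.
- move=> [[[i rem] cls] num] m' t [/= [mi iln] mnum ok vis] [fr fa].
  rewrite /= mi (fr v_n isT) /= mn -leqNgt => le lt.
  have iE : i = n by lia.
  rewrite iE in vis lt; split.
    have : \sum_(0 <= u < n) (arrs m a_num u == 0) <= n.
      rewrite -[leqRHS]muln1 -[n in leqRHS]subn0 -sum_nat_const_nat.
      by apply: leq_sum => u _; case: (_ == _).
    move: lt; rewrite /tarjan_potential /=; lia.
  (* At the end the stack is empty, and a visited state without a component would be on it. *)
  have cE x : x < n -> arrs m' a_comp x != 0.
    move=> xn; apply/negP => c0; have := ti_stk ok x.
    by rewrite in_nil c0 vis.
  exists cls; split=> //.
  + exact: ti_cls ok.
  + exact: ti_uniq ok.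
  + move=> c x c0; rewrite (ti_clsP ok) c0 andbT.
    case: eqP => [e|_]; rewrite ?andbF // andbT; apply/esym/(ti_dom ok).
    by apply: contraNneq c0 => /(ti_new ok); rewrite e => ->.
  + by move=> x y xn e; apply: ti_conn ok _ _ e _; apply: cE.
Qed.
End Tarjan.

(** * Blocks *)

Definition block_list (bs : seq nat) (m : memory) : Prop :=
  dseg (arrs m a_bnext) (arrs m a_bprev) 0 (regs m v_first) bs (regs m v_last) 0
  /\ uniq bs.

Definition block_members (dom : pred nat) (m : memory) : Prop :=
  members_ok dom (arrs m a_blk) (arrs m a_mnext) (arrs m a_mprev)
    (arrs m a_mhead) (arrs m a_size).

(** The command is a macro over a register name. Symbolic evaluation needs a concrete register,
    whence the enumeration of those that occur. *)
Lemma append_block_wp b bs m :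
  [\/ b = v_B, b = v_C | b = v_D] -> block_list bs m -> regs m b \notin bs ->
  wp (append_block b) m
    (fun t m' => t <= 5 /\ block_list (rcons bs (regs m b)) m').
Proof.
move=> bE [d u] nb; have := dseg_append u nb d.
have u' : uniq (rcons bs (regs m b)) by rewrite rcons_uniq nb.
by case: bE nb u' => -> nb u' d'; apply: wpfW => /=; case: ifP d' => l0 d'.
Qed.

Lemma remove_block_wp xs ys m :
  block_list (xs ++ regs m v_C :: ys) m ->
  wp (remove_block v_C) m (fun t m' => t <= 6 /\ block_list (xs ++ ys) m').
Proof.
move=> [d u]; have [_ _] := dseg_remove u d erefl erefl.
have u' : uniq (xs ++ ys).
  by move: u; rewrite !cat_uniq /= => /and3P[-> /norP[_ ->] /andP[_ ->]].
by move=> d'; apply: wpfW => /=; case: ifP d' => p0; case: ifP => q0 d'.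
Qed.

Lemma insert_state_wp s b dom m :
  s = v_i /\ b = v_B \/ s = v_s /\ b = v_D ->
  block_members dom m -> ~~ dom (regs m s) ->
  wp (insert_state s b) m (fun t m' => [/\ t <= 8,
    block_members (fun x => dom x || (x == regs m s)) m' &
    arrs m' a_blk = upd (arrs m a_blk) (regs m s) (regs m b)]).
Proof.
move=> sb ok nd; have := members_insert (b := regs m b) nd ok erefl.
by case: sb nd => -[-> ->] nd ok'; apply: wpfW => /=; case: ifP ok'.
Qed.

Lemma delete_state_wp dom m :
  block_members dom m -> dom (regs m v_s) ->
  regs m v_C = arrs m a_blk (regs m v_s) ->
  wp (delete_state v_s v_C) m (fun t m' => t <= 7 /\
    block_members (fun x => dom x && (x != regs m v_s)) m').
Proof.
move=> ok ds cE; have := members_delete ds ok cE erefl erefl.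
by move=> ok'; apply: wpfW => /=; case: ifP ok' => p0; case: ifP.
Qed.

(** Relates the test on [a_mhead], by which the program decides whether to append a block, to the
    states inserted so far. *)
Lemma members_head (dom : pred nat) blk nx pv hd sz b :
  members_ok dom blk nx pv hd sz ->
  if hd b == 0 then forall x, dom x -> blk x != b
  else exists2 x, dom x & blk x = b.
Proof.
move=> [mem ok]; have [[l d] _ memE _] := ok b.
have := dseg_head_nil d; case: ifPn => _ /esym.
  by move=> /eqP e x dx; apply/negP => bx; have := memE x; rewrite e dx bx.
case: (mem b) memE => // x s memE _.
by have := memE x; rewrite mem_head => /esym/andP[dx /eqP bx]; exists x.
Qed.

Lemma build_blocks_wp n m :
  regs m v_n = n -> regs m v_first = 0 -> regs m v_last = 0 ->
  (forall b, arrs m a_mhead b = 0) -> (forall b, arrs m a_size b = 0) ->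
  wp build_blocks m (fun t m' => [/\ t <= 18 * n + 3, regs m' v_nb = n,
    arrs m' a_blk =1 arrs m a_blk, block_members (fun x => x < n) m' &
    exists2 bs, block_list bs m' &
      forall b, b \in bs <-> exists2 x, x < n & arrs m a_blk x = b]).
Proof.
move=> mn f0 l0 h0 s0; apply: wpfW => /=.
pose I (g : nat * seq nat) m' :=
  [/\ regs m' v_i = g.1 /\ g.1 <= n, arrs m' a_blk =1 arrs m a_blk,
      block_members (fun x => x < g.1) m', block_list g.2 m' &
      forall b, b \in g.2 <-> exists2 x, x < g.1 & arrs m a_blk x = b].
apply: (wp_while (I := I) (phi := fun g => 18 * (n - g.1)) (g0 := (0, [::]))).
- split=> //=; last by split=> // -[].
    exists (fun=> [::]) => b /=; split=> //=; by exists 0; rewrite h0.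
- move=> [i bs] m' [/= [mi _] blkE ok [d u] bsP] [fr fa] /=.
  rewrite mi (fr v_n isT) /= mn => lti.
  apply: wp_seq; apply: wp_seq; apply: wp_assign; rewrite /= mi blkE.
  set b := arrs m a_blk i.
  apply: wp_seq.
  pose bs' := if b \in bs then bs else rcons bs b.
  have bsP' b' : b' \in bs' <-> exists2 x, x < i.+1 & arrs m a_blk x = b'.
    have -> : b' \in bs' = (b' == b) || (b' \in bs).
      rewrite /bs'; case: ifP => bb; last by rewrite mem_rcons inE.
      by case: eqP => // ->; rewrite bb.
    split.
      move=> /predU1P[->|/bsP[x lx xb]]; first by exists i.
      by exists x => //; apply: leqW.
    move=> [x]; rewrite ltnS leq_eqVlt => /predU1P[->|lt] <-; rewrite ?eqxx //.
    by apply/orP; right; apply/bsP; exists x.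
  set m1 := Memory _ _.
  have hb := members_head b ok.
  apply: (@wp_conseq _ _ (fun t m2 => [/\ t <= 6, block_list bs' m2 &
     frame (append_block v_B) m1 m2])).
    apply: wp_if => /=.
      move=> h0b; rewrite h0b in hb.
      have nb : b \notin bs.
        by apply/negP => /bsP[x /hb]; rewrite blkE => /eqP.
      rewrite /bs' (negPf nb).
      apply: wp_conseq; first exact: (wp_frame (@append_block_wp v_B bs m1 (Or31 _ _ erefl) (conj d u) nb)).
      by move=> t m2 [[le bl] f2]; split.
    move=> /negPf h0b; rewrite h0b in hb; case: hb => x xi xb.
    have bb : b \in bs by apply/bsP; exists x; rewrite -?blkE.
    by apply: wpfW; split=> //; rewrite /bs' bb.
  move=> t2 m2 [le2 bl2 [fr2 fa2]].
  have ok2 : block_members (fun x => x < i) m2.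
    by rewrite /block_members (fa2 a_blk isT) (fa2 a_mnext isT) (fa2 a_mprev isT)
      (fa2 a_mhead isT) (fa2 a_size isT).
  have i2 : regs m2 v_i = i by rewrite (fr2 v_i isT).
  apply: wp_conseq.
    apply: wp_frame; apply: (@insert_state_wp v_i v_B _ m2 _ ok2); first by left.
    by rewrite i2 ltnn.
  move=> t3 m3 [[le3 ok3 blk3] [fr3 fa3]]; apply: wpfW => /=.
  exists (i.+1, bs'); last by rewrite /=; lia.
  have blk3E : arrs m3 a_blk =1 arrs m a_blk.
    move=> x; rewrite blk3 i2 (fr2 v_B isT) (fa2 a_blk isT) /= /upd.
    by case: eqP => [->|].
  split=> //=; first by rewrite (fr3 v_i isT) i2.
    by apply: members_ext ok3 => // x; rewrite i2 ltnS [x <= i]leq_eqVlt orbC.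
  split; last by case: bl2.
  rewrite /= (fa3 a_bnext isT) (fa3 a_bprev isT) (fr3 v_first isT) (fr3 v_last isT).
  by case: bl2.
- move=> [i bs] m' t [/= [mi le] blkE ok [d u] bsP] [fr fa] /=.
  rewrite mi (fr v_n isT) (fr v_nb isT) /= mn -leqNgt => le2 let_.
  have iE : i = n by lia.
  rewrite iE in ok bsP; split=> //; first lia.
  by exists bs.
Qed.

(** * Marking components *)

(* [D] lists the marked components that have left the work stack [W]. *)
Definition marks_ok (D W : seq nat) (m : memory) : Prop :=
  [/\ regs m v_sp = size W,
      forall i, i < size W -> arrs m a_work i = nth 0 W i,
      uniq (W ++ D),
      forall c, (arrs m a_mark c == regs m v_now) = (c \in W ++ D) &
      forall c, arrs m a_mark c <= regs m v_now].

Definition mark_loop (f nx : arr) : cmd := (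
  WHILE v_x != 0 DO
    v_c <~ f!!(v_x.-1) ;;
    mark v_c ;;
    v_x <~ nx!!(v_x.-1)
  DONE)%cmd.

Lemma mark_loop_wp f nx D W xs m :
  f = a_comp /\ nx = a_mnext \/ f = a_dsrc /\ nx = a_dnext ->
  linked_list (arrs m nx) (regs m v_x) xs -> marks_ok D W m ->
  wp (mark_loop f nx) m (fun t m' => t <= 7 * size xs + 1 /\
    exists W', marks_ok D W' m' /\
      forall c, (c \in W' ++ D) = (c \in W ++ D) || (c \in [seq arrs m f x | x <- xs])).
Proof.
move=> fnx ll ok.
pose I (g : seq nat * seq nat) m' :=
  [/\ linked_list (arrs m nx) (regs m' v_x) g.1, marks_ok D g.2 m' &
      forall c, (c \in W ++ D) || (c \in [seq arrs m f x | x <- xs]) =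
        (c \in g.2 ++ D) || (c \in [seq arrs m f x | x <- g.1])].
apply: (wp_while (I := I) (phi := fun g => 7 * size g.1) (g0 := (xs, W))) => //.
- move=> [ys V] m' [/= lx [spV wV uV mV leV] memV] [fr fa] /= /eqP x0.
  have [ys' [ysE ll']] := linked_list_nz lx x0.
  have fE : arrs m' f = arrs m f by case: fnx => -[-> _]; apply: fa.
  have nxE : arrs m' nx = arrs m nx by case: fnx => -[_ ->]; apply: fa.
  set x := (regs m' v_x).-1 in ysE ll'.
  apply: wp_seq; apply: wp_assign; rewrite /= fE -/x.
  have mVx := mV (arrs m f x).
  pose V' := if arrs m f x \in V ++ D then V else rcons V (arrs m f x).
  have memV' c : (c \in V' ++ D) = (c == arrs m f x) || (c \in V ++ D).
    rewrite /V'; case: ifP => xV; last by rewrite cat_rcons !mem_cat inE orbCA.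
    by case: eqP => // ->; rewrite xV.
  set m1 := Memory _ _.
  have w : wp (mark v_c) m1 (fun t m2 => t <= 4 /\ marks_ok D V' m2).
    apply: wpfW => /=; rewrite mVx /V'.
    case: (boolP (arrs m f x \in V ++ D)) => xV /=; first by split.
    split=> //; split=> //=.
    + by rewrite size_rcons spV.
    + move=> i; rewrite size_rcons ltnS leq_eqVlt nth_rcons spV.
      case: (eqVneq i (size V)) => [->|_] /=; first by rewrite ltnn.
      by move=> lt; rewrite lt wV.
    + by rewrite cat_rcons uniq_catC /= mem_cat orbC -mem_cat xV uniq_catC.
    + move=> c; rewrite cat_rcons mem_cat inE orbCA -mem_cat.
      by case: (eqVneq c (arrs m f x)) => [_|_]; rewrite ?eqxx.
    + by move=> c; case: ifP.
  apply: wp_seq; apply: wp_conseq (wp_frame w) _.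
  move=> t m2 [[le ok2] [fr2 fa2]]; apply: wpfW => /=.
  have nx2 : arrs m2 nx = arrs m nx.
    by rewrite -nxE; case: fnx => -[_ ->]; apply: fa2.
  rewrite nx2 (fr2 v_x isT) /= -/x.
  exists (ys', V'); last by rewrite /= ysE /=; lia.
  split=> // c; rewrite /= memV memV' ysE /= inE.
  by rewrite -orbA orbCA.
- move=> [ys V] m' t [/= lx okV memV] [fr fa] /= /negPn/eqP x0 le.
  rewrite x0 in lx; have ys0 := linked_list0 lx; subst ys.
  split; first by move: le; rewrite /=; lia.
  by exists V; split=> // c; rewrite memV orbF.
Qed.

Lemma mark_block_components_wp xs m :
  linked_list (arrs m a_mnext) (arrs m a_mhead (regs m v_B)) xs ->
  (forall c, arrs m a_mark c <= regs m v_now) ->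
  wp mark_block_components m (fun t m' => [/\ t <= 7 * size xs + 4,
    regs m' v_now = (regs m v_now).+1 &
    exists W, marks_ok [::] W m' /\
      forall c, (c \in W) = (c \in [seq arrs m a_comp x | x <- xs])]).
Proof.
move=> ll le; apply: wpfW => /=; set m1 := Memory _ _.
(* No time stamp exceeds the old [v_now], so incrementing it erases all marks at once. *)
have ok : marks_ok [::] [::] m1.
  by split=> //= c; [rewrite in_nil; have := le c; lia | have := le c; lia].
apply: wp_conseq.
  by apply: wp_frame; apply: (@mark_loop_wp a_comp a_mnext [::] [::] xs m1) => //; left.
move=> t m' [[let_ [W' [ok' memW']]] [fr _]]; split; [lia|exact: (fr v_now isT)|].
by exists W'; split=> // c; have := memW' c; rewrite cats0.
Qed.

(** * Backward search in the DAG of components *)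

Section Collect.

Variables (n M : nat) (src tgt comp : nat -> nat).
Variables (cls preds : nat -> seq nat) (E : nat -> Prop).

Hypothesis clsP : forall c x, c != 0 -> (x \in cls c) = (x < n) && (comp x == c).
Hypothesis cls_uniq : forall c, uniq (cls c).
Hypothesis predsP : forall d j, (j \in preds d) =
  [&& j < M, comp (src j) != comp (tgt j) & comp (tgt j) == d].
Hypothesis preds_uniq : forall d, uniq (preds d).
Hypothesis comp_nz : forall x, x < n -> comp x != 0.
Hypothesis tgt_lt : forall j, j < M -> tgt j < n.
Hypothesis src_lt : forall j, j < M -> src j < n.
Hypothesis E_comp : forall x y, x < n -> comp x = comp y -> E y -> E x.
Hypothesis E_edge : forall j, j < M -> E (tgt j) -> E (src j).

Definition collected (L : seq nat) (m : memory) : Prop :=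
  regs m v_len = size L /\ forall i, i < size L -> arrs m a_reach i = nth 0 L i.

Definition component_of_E (c : nat) : Prop := exists2 x, x < n & comp x = c /\ E x.

(** [L] and [J] are the states and the DAG entries already scanned. Both are determined by the
    expanded components [D] and free of repetitions, so their lengths are at most [n] and [M]; this
    makes the total cost of the inner loops linear. *)
Definition collect_loop_inv (W D L J : seq nat) (m : memory) : Prop :=
  [/\ marks_ok D W m, collected L m /\ uniq L /\ uniq J,
      forall x, (x \in L) = (x < n) && (comp x \in D),
      forall j, (j \in J) =
        [&& j < M, comp (src j) != comp (tgt j) & comp (tgt j) \in D] &
      (forall c, c \in W ++ D -> component_of_E c) /\
      forall j, j < M -> comp (tgt j) \in D -> comp (src j) \in W ++ D].

Lemma collect_states_wp L xs m :
  linked_list (arrs m a_cnext) (regs m v_x) xs -> collected L m ->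
  wp (WHILE v_x != 0 DO
      a_reach!!v_len <~ v_x.-1 ;;
      v_len <~ v_len.+1 ;;
      v_x <~ a_cnext!!(v_x.-1)
    DONE)%cmd m
  (fun t m' => t <= 4 * size xs + 1 /\ collected (L ++ xs) m').
Proof.
move=> ll co.
pose I (g : seq nat * seq nat) m' :=
  [/\ linked_list (arrs m a_cnext) (regs m' v_x) g.2, collected g.1 m' &
      L ++ xs = g.1 ++ g.2].
apply: (wp_while (I := I) (phi := fun g => 4 * size g.2) (g0 := (L, xs))) => //.
- move=> [K ys] m' [/= lx [lenK reachK] eqK] [fr fa] /= /eqP x0.
  have [ys' [ysE ll']] := linked_list_nz lx x0.
  apply: wpfW => /=; rewrite (fa a_cnext isT).
  exists (rcons K (regs m' v_x).-1, ys'); last by rewrite /= ysE /=; lia.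
  split=> //=; last by rewrite cat_rcons eqK ysE.
  split=> /=; rewrite size_rcons ?lenK // => i.
  rewrite ltnS leq_eqVlt nth_rcons.
  case: (eqVneq i (size K)) => [->|_] /=; first by rewrite ltnn.
  by move=> lt; rewrite lt reachK.
- move=> [K ys] m' t [/= lx co' eqK] [fr fa] /= /negPn/eqP x0 le.
  rewrite x0 in lx; have ys0 := linked_list0 lx; subst ys.
  split; first by move: le; rewrite /=; lia.
  by rewrite eqK cats0.
Qed.

(** The list [L] is enclosed from two sides: it stays inside [E], and it contains the starting
    components and is closed under predecessors. The potential takes 4 for each state, 7 for each
    DAG entry and 8 for the fixed cost of expanding a component. *)
Lemma collect_EF_wp W m :
  arrs m a_comp = comp ->
  linked_lists (arrs m a_cnext) (arrs m a_chead) cls ->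
  linked_lists (arrs m a_dnext) (arrs m a_dhead) preds ->
  (forall j, j < M -> comp (src j) != comp (tgt j) ->
     arrs m a_dsrc j = comp (src j)) ->
  marks_ok [::] W m -> (forall c, c \in W -> component_of_E c) ->
  wp collect_EF m (fun t m' => t <= 4 * n + 7 * M + 8 * n + 2 /\
    exists L, [/\ collected L m', uniq L,
      forall x, x \in L -> x < n /\ E x,
      forall x, x < n -> comp x \in W -> x \in L &
      (forall j, j < M -> tgt j \in L -> src j \in L) /\
      forall c, arrs m' a_mark c <= regs m' v_now]).
Proof.
move=> compE lcls lpreds dsrcE okW WE; apply: wpfW => /=.
pose I (g : seq nat * seq nat * seq nat * seq nat) m' :=
  collect_loop_inv g.1.1.1 g.1.1.2 g.1.2 g.2 m' /\ {subset W <= g.1.1.1 ++ g.1.1.2}.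
apply: (wp_while (I := I) (phi := fun g =>
   4 * (n - size g.1.2) + 7 * (M - size g.2) + 8 * (n - size g.1.1.2))
   (g0 := (W, [::], [::], [::]))).
- split; last by move=> c; rewrite cats0.
  split=> //=; first by move=> x; rewrite andbF.
    by move=> j; rewrite !andbF.
  by split=> // c; rewrite cats0; apply: WE.
- move=> [[[V D] L] J] m'; rewrite /I /= => -[[[spV wV uV mV leV] [coL [uL uJ]] memL memJ [VE clo]] subW].
  move=> [fr fa] /= /eqP sp0.
  case/lastP: V => [|V d] in spV wV uV mV VE clo subW *; first by rewrite spV in sp0.
  have topE : arrs m' a_work (regs m' v_sp).-1 = d.
    by rewrite spV size_rcons wV ?size_rcons // nth_rcons ltnn eqxx.
  rewrite cat_rcons in uV mV VE clo subW.
  have [|x xn [xd Ex]] := VE d; first by rewrite mem_cat mem_head orbT.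
  have d0 : d != 0 by rewrite -xd comp_nz.
  have dD : d \notin D by move: uV; rewrite cat_uniq => /and3P[_ _ /andP[]].
  apply: wp_seq; apply: wp_assign; apply: wp_seq; apply: wp_assign.
  apply: wp_seq; apply: wp_assign; rewrite /= topE.
  set m1 := Memory _ _.
  have ll1 : linked_list (arrs m1 a_cnext) (regs m1 v_x) (cls d).
    by rewrite /= (fa a_chead isT) (fa a_cnext isT); apply: lcls.
  apply: wp_seq; apply: wp_conseq; first exact: wp_frame (collect_states_wp ll1 coL).
  move=> t2 m2 [[le2 co2] [fr2 fa2]].
  apply: wp_seq; apply: wp_assign; rewrite /= (fr2 v_d isT) /=.
  set m3 := Memory _ _.
  have ok3 : marks_ok (d :: D) V m3.
    split=> //=.
    - by rewrite (fr2 v_sp isT) /= spV size_rcons.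
    - move=> i lti; rewrite (fa2 a_work isT) /= wV ?size_rcons ?nth_rcons ?lti //.
      exact: leqW.
    - by move=> c; rewrite (fr2 v_now isT) (fa2 a_mark isT) /=.
    - by move=> c; rewrite (fr2 v_now isT) (fa2 a_mark isT) /=.
  have ll3 : linked_list (arrs m3 a_dnext) (regs m3 v_x) (preds d).
    by rewrite /= (fa2 a_dhead isT) (fa2 a_dnext isT) /= (fa a_dhead isT) (fa a_dnext isT); apply: lpreds.
  have dsrc3 : {in preds d, arrs m3 a_dsrc =1 comp \o src}.
    move=> j; rewrite predsP => /and3P[jM neq _].
    by rewrite /= (fa2 a_dsrc isT) /= (fa a_dsrc isT) /= dsrcE.
  apply: wp_conseq.
    apply: wp_frame; apply: (@mark_loop_wp a_dsrc a_dnext (d :: D) V (preds d) m3) => //.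
    by right.
  move=> t4 m4 [[le4 [V' [ok4 memV']]] [fr4 fa4]].
  have disL : uniq (L ++ cls d).
    rewrite cat_uniq uL cls_uniq andbT; apply/hasPn => y.
    rewrite clsP // memL => /andP[_ /eqP->]; by rewrite (negPf dD) andbF.
  have disJ : uniq (J ++ preds d).
    rewrite cat_uniq uJ preds_uniq andbT; apply/hasPn => j.
    by rewrite predsP memJ => /and3P[_ _ /eqP->]; rewrite (negPf dD) !andbF.
  have VD c : c \in V ++ d :: D -> c \in V' ++ d :: D by rewrite memV' => ->.
  exists (V', d :: D, L ++ cls d, J ++ preds d); last first.
    have sL : size (L ++ cls d) <= n.
      rewrite -[n](size_iota 0); apply: uniq_leq_size => // y.
      rewrite mem_iota mem_cat memL clsP //; case/orP=> /andP[] //.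
    have sJ : size (J ++ preds d) <= M.
      rewrite -[M](size_iota 0); apply: uniq_leq_size => // y.
      by rewrite mem_iota mem_cat memJ predsP; case/orP => /and3P[].
    (* Every marked component contains a state, so there are at most [n] of them. *)
    have sD : size (d :: D) <= n.
      rewrite -[n](size_iota 0) -(size_map comp (iota _ _)); apply: uniq_leq_size.
        by move: uV; rewrite cat_uniq => /and3P[].
      move=> c cD; have [|y yn [<- _]] := VE c; first by rewrite mem_cat cD orbT.
      by apply: map_f; rewrite mem_iota.
    rewrite !size_cat /= in sL sJ sD *; lia.
  split; last by move=> c /subW /VD.
  split=> //.
  + split=> //; split; last first.
      move=> i /(proj2 co2); rewrite /= (fa4 a_reach isT) /=; exact.
    by rewrite (fr4 v_len isT) /=; case: co2.
  + move=> y; rewrite /= mem_cat memL clsP // inE -andb_orr; congr (_ && _).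
    by rewrite orbC.
  + move=> j; rewrite /= mem_cat memJ predsP inE orbC -!andb_orr.
    by case: (_ < _).
  split.
    move=> c; rewrite /= memV' => /orP[/VE//|/mapP[j jd ->]]; rewrite dsrc3 //=.
    move: jd; rewrite predsP => /and3P[jM _ /eqP jd].
    exists (src j); [exact: src_lt|split=> //]; apply: E_edge => //.
    by apply: E_comp Ex; [exact: tgt_lt|rewrite jd].
  move=> j jM; rewrite /= inE => /predU1P[jd|jD]; last by apply/VD/clo.
  (* A transition inside the component has no DAG entry, but its source lies in [d], which is
     already marked. *)
  case: (eqVneq (comp (src j)) (comp (tgt j))) => [->|neq].
    by rewrite jd mem_cat mem_head orbT.
  have jp : j \in preds d by rewrite predsP jM neq jd eqxx.
  rewrite memV'; apply/orP; right; apply/mapP; exists j => //.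
  by rewrite dsrc3.
- move=> [[[V D] L] J] m' t; rewrite /I /= => -[[[spV wV uV mV leV] [coL [uL uJ]] memL memJ [VE clo]] subW].
  move=> _ /= /negPn/eqP sp0 le.
  have V0 : V = [::] by apply/eqP; rewrite -size_eq0 -spV sp0.
  rewrite /= in memL memJ VE clo subW coL uL; rewrite V0 /= in VE clo subW.
  split; first by move: le; rewrite /=; lia.
  exists L; split=> //.
  + move=> x; rewrite memL => /andP[xn xD]; split=> //.
    by have [y yn [cy Ey]] := VE _ xD; apply: E_comp Ey.
  + by move=> x xn xW; rewrite memL xn subW.
  + split=> // j jM; rewrite !memL => /andP[_ tD].
    by rewrite src_lt // clo.
Qed.
End Collect.

(** * Splitting blocks *)

Definition touch_loop : cmd := (
  FOR v_k BELOW v_len DO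
    v_C <~ a_blk!!(a_reach!!v_k) ;;
    IF a_seen!!v_C != v_now THEN
      a_seen!!v_C <~ v_now ;;
      a_hit!!v_C <~ 0 ;;
      a_touch!!v_ntouch <~ v_C ;;
      v_ntouch <~ v_ntouch.+1
    FI ;;
    a_hit!!v_C <~ (a_hit!!v_C).+1
  DONE)%cmd.

Definition twin_loop : cmd := (
  FOR v_k BELOW v_ntouch DO
    v_C <~ a_touch!!v_k ;;
    IF a_hit!!v_C < a_size!!v_C THEN
      v_D <~ v_nb ;;
      v_nb <~ v_nb.+1 ;;
      a_twin!!v_C <~ v_D.+1 ;;
      remove_block v_C ;;
      append_block v_D ;;
      append_block v_C
    ELSE
      a_twin!!v_C <~ 0
    FI
  DONE)%cmd.

Definition move_loop : cmd := (
  FOR v_k BELOW v_len DO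
    v_s <~ a_reach!!v_k ;;
    v_C <~ a_blk!!v_s ;;
    IF a_twin!!v_C != 0 THEN
      v_D <~ (a_twin!!v_C).-1 ;;
      delete_state v_s v_C ;;
      insert_state v_s v_D
    FI
  DONE)%cmd.

Lemma mem_take_S (L : seq nat) k x :
  k < size L -> (x \in take k.+1 L) = (x == nth 0 L k) || (x \in take k L).
Proof. by move=> lt; rewrite (take_nth 0) // mem_rcons inE. Qed.

Definition touched (L T : seq nat) (blk : nat -> nat) (m : memory) : Prop :=
  [/\ regs m v_ntouch = size T, forall i, i < size T -> arrs m a_touch i = nth 0 T i,
      uniq T, T =i [seq blk x | x <- L] &
      forall C, C \in T -> arrs m a_hit C = count (fun x => blk x == C) L].

Lemma touch_loop_wp L m :
  collected L m -> regs m v_ntouch = 0 ->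
  (forall c, arrs m a_seen c < regs m v_now) ->
  wp touch_loop m (fun t m' => [/\ t <= 9 * size L + 2,
    exists T, touched L T (arrs m a_blk) m' &
    forall c, arrs m' a_seen c <= regs m v_now]).
Proof.
move=> [lenL reachL] nt0 seen_lt; apply: wpfW => /=.
set blk := arrs m a_blk; set now := regs m v_now.
pose I (g : nat * seq nat) m' :=
  [/\ regs m' v_k = g.1 /\ g.1 <= size L, touched (take g.1 L) g.2 blk m',
      forall C, (arrs m' a_seen C == now) = (C \in g.2) &
      forall C, arrs m' a_seen C <= now].
apply: (wp_while (I := I) (phi := fun g => 9 * (size L - g.1)) (g0 := (0, [::]))).
- split=> //=; rewrite ?take0; first by split.
    by move=> C; rewrite in_nil; have := seen_lt C; rewrite -/now; lia.
  by move=> C; apply/ltnW/seen_lt.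
- move=> [k T] m' [/= [mk _] [nT touchT uT memT hitT] seenT seen_le] [fr fa] /=.
  rewrite mk (fr v_len isT) /= lenL => ltk; apply: wpfW => /=.
  rewrite mk (fa a_reach isT) (fa a_blk isT) (fr v_now isT) /= reachL // -/blk -/now.
  set x := nth 0 L k; set C := blk x; rewrite seenT.
  have memT' D : (D \in [seq blk y | y <- take k.+1 L]) = (D == C) || (D \in T).
    by rewrite (take_nth 0) // map_rcons mem_rcons inE memT.
  have count' D : count (fun y => blk y == D) (take k.+1 L) =
      count (fun y => blk y == D) (take k L) + (D == C).
    by rewrite (take_nth 0) // -cats1 count_cat /= addn0 eq_sym.
  case: (boolP (C \in T)) => CT /=.
    exists (k.+1, T); last by rewrite /=; lia.
    split=> //=; split=> //=.
      by move=> D; rewrite memT'; case: eqP => // ->.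
    move=> D DT; rewrite count'; case: eqP => [->|_]; first by rewrite hitT ?addn1.
    by rewrite addn0 hitT.
  exists (k.+1, rcons T C); last by rewrite /=; lia.
  split=> //=; first split=> //=.
  + by rewrite size_rcons nT.
  + move=> i; rewrite size_rcons ltnS leq_eqVlt nth_rcons nT.
    case: (eqVneq i (size T)) => [->|_] /=; first by rewrite ltnn.
    by move=> lt; rewrite lt touchT.
  + by rewrite rcons_uniq CT.
  + by move=> D; rewrite memT' mem_rcons inE.
  + move=> D; rewrite mem_rcons inE count' eqxx; case: (eqVneq D C) => [-> _|_ DT].
      suff -> : count (fun y => blk y == C) (take k L) = 0 by [].
      apply/eqP; rewrite -leqn0 leqNgt -has_count; apply: contra CT.
      by rewrite memT => /hasP[y ky /eqP <-]; apply: map_f.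
    by rewrite addn0 hitT.
  + by move=> D; rewrite mem_rcons inE -seenT; case: (eqVneq D C) => [_|//]; rewrite eqxx.
  + by move=> D; case: ifP.
- move=> [k T] m' t [/= [mk kL] ok seenT seen_le] [fr fa].
  rewrite /= mk (fr v_len isT) /= lenL -leqNgt => le le2; split; first lia.
    by exists T; move: ok; rewrite take_oversize.
  by [].
Qed.

(** [T] lists the blocks that have received a twin so far and [app] the entries moved or created at
    the end of the list. As [tw] codes its items with a shift by one, the twins themselves are
    numbered from [nb] up to [nb + size T], excluded. *)
Definition twins_ok (bs T app : seq nat) (nb : nat) (tw : nat -> nat) (m : memory) :=
  [/\ block_list ([seq b <- bs | b \notin T] ++ app) m,
      regs m v_nb = nb + size T,
      size app = 2 * size T,
      forall b, b \in app -> b \in T \/ exists2 C, C \in T & tw C = b.+1 &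
      forall C, C \in T -> [/\ C \in app, nb < tw C <= nb + size T, (tw C).-1 \in app &
        forall C', C' \in T -> tw C = tw C' -> C = C']].

Lemma twin_loop_wp (bs TL : seq nat) m :
  block_list bs m -> (forall b, b \in bs -> b < regs m v_nb) ->
  regs m v_ntouch = size TL -> uniq TL ->
  (forall i, i < size TL -> arrs m a_touch i = nth 0 TL i) ->
  {subset TL <= bs} ->
  wp twin_loop m (fun t m' => t <= 26 * size TL + 2 /\
    let T := [seq C <- TL | arrs m a_hit C < arrs m a_size C] in
    (exists app, twins_ok bs T app (regs m v_nb) (arrs m' a_twin) m') /\
    forall C, C \in TL -> (arrs m' a_twin C != 0) = (C \in T)).
Proof.
move=> bl nb_lt ntE uTL touchE subTL; apply: wpfW => /=.
set nb := regs m v_nb.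
pose T k := [seq C <- take k TL | arrs m a_hit C < arrs m a_size C].
pose I (g : nat * seq nat) m' :=
  [/\ regs m' v_k = g.1 /\ g.1 <= size TL,
      twins_ok bs (T g.1) g.2 nb (arrs m' a_twin) m' &
      forall C, C \in take g.1 TL -> (arrs m' a_twin C != 0) = (C \in T g.1)].
apply: (wp_while (I := I) (phi := fun g => 26 * (size TL - g.1)) (g0 := (0, [::]))).
- split=> //=; rewrite ?take0 //; split; rewrite /T ?take0 ?addn0 //=.
  by rewrite cats0 filter_predT; case: bl.
- move=> [k app] m' [/= [mk _] [bl' nbE sapp appP TP] twP] [fr fa].
  rewrite /= mk (fr v_ntouch isT) /= ntE => ltk.
  apply: wp_seq; apply: wp_seq; apply: wp_assign.
  rewrite /= mk (fa a_touch isT) /= touchE //.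
  set C := nth 0 TL k.
  have CTL : C \in TL by apply: mem_nth.
  have CTk : C \notin take k TL.
    have := uTL; rewrite -[TL in uniq TL](cat_take_drop k.+1) (take_nth 0) //.
    by rewrite cat_uniq rcons_uniq => /andP[/andP[]].
  have CT : C \notin T k by apply: contra CTk; rewrite mem_filter => /andP[].
  have TS : T k.+1 = if arrs m a_hit C < arrs m a_size C then rcons (T k) C else T k.
    by rewrite /T (take_nth 0) // filter_rcons.
  have takeS x : x \in take k.+1 TL -> x = C \/ x \in take k TL.
    by rewrite mem_take_S // => /predU1P.
  apply: wp_if; rewrite /= (fa a_hit isT) (fa a_size isT) /= => hit; last first.
    apply: wpfW; apply: wpfW => /=; rewrite mk; exists (k.+1, app); last by rewrite /=; lia.
    rewrite (negPf hit) in TS.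
    have twC x : x \in T k -> (if x == C then 0 else arrs m' a_twin x) = arrs m' a_twin x.
      by case: eqP CT => // -> /negPf->.
    split=> //=; rewrite ?TS.
      split=> //.
        move=> b /appP[bT|[D DT Db]]; [by left|right; exists D => //].
        by rewrite twC.
      move=> D DT; have [Da Dn Dt Di] := TP D DT; rewrite twC //; split=> //.
      by move=> D' DT'; rewrite twC //; apply: Di.
    move=> x xk; case: (eqVneq x C) => [->|neq]; first by rewrite (negPf CT).
    by case: (takeS x xk) => [e|/twP//]; rewrite e eqxx in neq.
  rewrite hit in TS.
  have Cbs : C \in [seq b <- bs | b \notin T k] by rewrite mem_filter CT subTL.
  have [xs [ys fE]] : exists xs ys, [seq b <- bs | b \notin T k] = xs ++ C :: ys.
    by case/splitPr: Cbs => xs ys; exists xs, ys.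
  have fE' : [seq b <- bs | b \notin T k.+1] = xs ++ ys.
    have -> : [seq b <- bs | b \notin T k.+1] = [seq b <- xs ++ C :: ys | b != C].
      rewrite -fE -filter_predI; apply: eq_filter => b /=.
      by rewrite TS mem_rcons inE negb_or.
    case: bl' => _; rewrite fE -catA cat_uniq /= => /and3P[_ /norP[n1 _] /andP[n2 _]].
    rewrite mem_cat negb_or in n2; case/andP: n2 => n2 _.
    rewrite filter_cat /= eqxx /=; congr (_ ++ _); apply/all_filterP/allP => y ym /=;
      by [apply: contraNneq n1 => <- | apply: contraNneq n2 => <-].
  apply: wp_seq; apply: wp_assign; apply: wp_seq; apply: wp_assign.
  apply: wp_seq; apply: wp_assign; rewrite /= nbE; set m1 := Memory _ _.
  have bl1 : block_list (xs ++ regs m1 v_C :: (ys ++ app)) m1.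
    by move: bl'; rewrite fE -catA.
  (* All numbers on the list are below the counter, so the number given to the twin is new. *)
  have lt_nb b : b \in xs ++ C :: ys ++ app -> b < nb + size (T k).
    rewrite -cat_cons catA -fE mem_cat mem_filter => /orP[/andP[_ /nb_lt]|]; first by rewrite -/nb; lia.
    move=> /appP[bT|[D DT Db]]; last by have [_ + _ _] := TP D DT; rewrite Db; lia.
    have : b \in bs by apply: subTL; move: bT; rewrite mem_filter => /andP[_ /mem_take].
    by move/nb_lt; rewrite -/nb; lia.
  apply: wp_seq; apply: wp_conseq; first exact: wp_frame (remove_block_wp bl1).
  move=> t2 m2 [[le2 bl2] [fr2 fa2]].
  have D2 : regs m2 v_D = nb + size (T k) by rewrite (fr2 v_D isT).
  have C2 : regs m2 v_C = C by rewrite (fr2 v_C isT).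
  have Dn : regs m2 v_D \notin xs ++ ys ++ app.
    rewrite D2; apply/negP => Dm; suff: nb + size (T k) < nb + size (T k) by rewrite ltnn.
    by apply: lt_nb; move: Dm; rewrite !mem_cat inE mem_cat => /or3P[->|->|->]; rewrite ?orbT.
  apply: wp_seq; apply: wp_conseq.
    exact: wp_frame (@append_block_wp v_D _ m2 (Or33 _ _ erefl) bl2 Dn).
  move=> t3 m3 [[le3 bl3] [fr3 fa3]].
  have C3 : regs m3 v_C = C by rewrite (fr3 v_C isT).
  have Cn : regs m3 v_C \notin rcons (xs ++ ys ++ app) (regs m2 v_D).
    rewrite C3 D2 mem_rcons inE negb_or; apply/andP; split.
      have : C < nb + size (T k) by apply: lt_nb; rewrite mem_cat mem_head orbT.
      by rewrite ltn_neqAle => /andP[].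
    have [_] := bl1; rewrite cat_uniq /= => /and3P[_ /norP[n1 _] /andP[n2 _]].
    by rewrite mem_cat negb_or n1 n2.
  apply: wp_conseq.
    exact: wp_frame (@append_block_wp v_C _ m3 (Or32 _ _ erefl) bl3 Cn).
  move=> t4 m4 [[le4 bl4] [fr4 fa4]]; apply: wpfW => /=.
  rewrite (fr4 v_k isT) (fr3 v_k isT) (fr2 v_k isT) /= mk.
  exists (k.+1, rcons (rcons app (nb + size (T k))) C); last by rewrite /=; lia.
  have twE : arrs m4 a_twin = upd (arrs m' a_twin) C (nb + size (T k)).+1.
    by rewrite (fa4 a_twin isT) (fa3 a_twin isT) (fa2 a_twin isT).
  have twC x : x \in T k -> arrs m4 a_twin x = arrs m' a_twin x.
    by move=> xT; rewrite twE upd_other //; apply: contraNneq CT => <-.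
  have twCC : arrs m4 a_twin C = (nb + size (T k)).+1 by rewrite twE upd_same.
  split=> //=; rewrite ?TS.
    split.
    + rewrite -TS fE'; move: bl4; rewrite C3 D2.
      by rewrite -!rcons_cat -!catA.
    + by rewrite /= (fr4 v_nb isT) (fr3 v_nb isT) (fr2 v_nb isT) /= size_rcons addnS.
    + by rewrite !size_rcons sapp; lia.
    + move=> b; rewrite mem_rcons inE mem_rcons inE => /or3P[/eqP->|/eqP->|/appP[bT|[D DT Db]]].
      * by left; rewrite mem_rcons mem_head.
      * by right; exists C; rewrite ?mem_rcons ?mem_head.
      * by left; rewrite mem_rcons inE bT orbT.
      * by right; exists D; rewrite ?mem_rcons ?inE ?DT ?orbT // twC.
    + move=> D; rewrite mem_rcons inE size_rcons /= => /predU1P[->|DT].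
        rewrite twCC; split; rewrite ?mem_rcons ?inE ?mem_rcons ?inE ?eqxx ?orbT //; first lia.
        move=> D'; rewrite mem_rcons inE => /predU1P[->//|DT']; rewrite twC // => e.
        by have [_ + _ _] := TP D' DT'; rewrite -e; lia.
      have [Da Dl Dt Di] := TP D DT; rewrite twC //.
      split; rewrite ?mem_rcons ?inE ?mem_rcons ?inE ?Da ?Dt ?orbT //; first lia.
      move=> D'; rewrite mem_rcons inE => /predU1P[->|DT'].
        by rewrite twCC => e; move: Dl; rewrite e; lia.
      by rewrite twC //; apply: Di.
  move=> x xk; rewrite mem_rcons inE twE /upd; case: (eqVneq x C) => [//|neq] /=.
  by case: (takeS x xk) => [e|/twP//]; rewrite e eqxx in neq.
- move=> [k app] m' t [/= [mk kle] ok twP] [fr fa].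
  rewrite /= mk (fr v_ntouch isT) /= ntE -leqNgt => le le2.
  have kE : k = size TL by lia.
  rewrite /T kE take_size in ok twP.
  split; first lia.
  by split=> //; exists app.
Qed.

Lemma move_loop_wp n L m :
  collected L m -> uniq L -> (forall x, x \in L -> x < n) ->
  block_members (fun x => x < n) m ->
  let blk := arrs m a_blk in let tw := arrs m a_twin in
  wp move_loop m (fun t m' => [/\ t <= 22 * size L + 2,
    block_members (fun x => x < n) m' &
    forall x, arrs m' a_blk x =
      if (x \in L) && (tw (blk x) != 0) then (tw (blk x)).-1 else blk x]).
Proof.
move=> [lenL reachL] uL ltL ok blk tw; apply: wpfW => /=.
pose I k m' :=
  [/\ regs m' v_k = k /\ k <= size L, block_members (fun x => x < n) m' &
    forall x, arrs m' a_blk x =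
      if (x \in take k L) && (tw (blk x) != 0) then (tw (blk x)).-1 else blk x].
apply: (wp_while (I := I) (phi := fun k => 22 * (size L - k)) (g0 := 0)).
- by split=> //= x; rewrite take0.
- move=> k m' [/= [mk _] ok' blkE] [fr fa].
  rewrite /= mk (fr v_len isT) /= lenL => ltk.
  apply: wp_seq; apply: wp_seq; apply: wp_assign; apply: wp_seq; apply: wp_assign.
  rewrite /= mk (fa a_reach isT) /= reachL //.
  set s := nth 0 L k.
  (* Since [L] has no repetition, [s] has not been moved yet, and the program still reads its
     original block. *)
  have sk : s \notin take k L.
    have := uL; rewrite -[L in uniq L](cat_take_drop k.+1) (take_nth 0) //.
    by rewrite cat_uniq rcons_uniq => /andP[/andP[]].
  have sn : s < n by apply: ltL; apply: mem_nth.
  rewrite blkE (negPf sk) /=; set C := blk s.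
  have memS := mem_take_S _ ltk.
  apply: wp_if; rewrite /= (fa a_twin isT) -/tw => twC; last first.
    apply: wpfW; apply: wpfW => /=; rewrite mk; exists k.+1; last by lia.
    split=> // x; rewrite blkE memS -/s; case: (eqVneq x s) => [->|//].
    by rewrite (negPf sk) /= -/C (negPf twC).
  apply: wp_seq; apply: wp_assign; rewrite /= (fa a_twin isT) -/tw.
  set m1 := Memory _ _.
  apply: wp_seq; apply: wp_conseq.
    apply: wp_frame; apply: (@delete_state_wp _ m1 ok' sn).
    by rewrite /= blkE (negPf sk).
  move=> t2 m2 [[le2 ok2] [fr2 fa2]]; rewrite /= in ok2.
  have s2 : regs m2 v_s = s by rewrite (fr2 v_s isT).
  apply: wp_conseq.
    apply: wp_frame; apply: (@insert_state_wp v_s v_D _ m2 _ ok2); first by right.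
    by rewrite s2 eqxx andbF.
  move=> t3 m3 [[le3 ok3 blk3] [fr3 fa3]]; apply: wpfW => /=.
  rewrite (fr3 v_k isT) (fr2 v_k isT) /= mk; exists k.+1; last by lia.
  split=> //=.
    apply: members_ext ok3 => // x /=; rewrite s2.
    by case: (eqVneq x s) => [->|_]; rewrite ?sn ?andbT ?orbF.
  move=> x; rewrite blk3 s2 (fa2 a_blk isT) (fr2 v_D isT) /= /upd memS -/s.
  by case: (eqVneq x s) => [->|_] /=; rewrite ?twC // blkE.
- move=> k m' t [/= [mk kle] ok' blkE] [fr fa].
  rewrite /= mk (fr v_len isT) /= lenL -leqNgt => le le2; split=> //; first lia.
  by move=> x; rewrite blkE take_oversize.
Qed.

Definition blocks_of (n : nat) (blk : nat -> nat) (bs : seq nat) : Prop :=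
  forall b, b \in bs <-> exists2 x, x < n & blk x = b.

Lemma size_blocks n blk bs : uniq bs -> blocks_of n blk bs -> size bs <= n.
Proof.
move=> u bsP; rewrite -[n](size_iota 0) -(size_map blk (iota _ _)).
apply: uniq_leq_size => // b /bsP[x xn <-]; by apply: map_f; rewrite mem_iota.
Qed.

(** Two states share a block afterwards iff they did before and lie on the same side of [L]: twins
    have fresh, pairwise distinct numbers, and a touched block without a twin is contained in [L].
    The bound adds $9n+2$, $26n+2$ and $22n+2$ for the three loops and 1 for the first
    assignment. *)
Lemma split_wp n bs L m :
  let blk := arrs m a_blk in
  collected L m -> uniq L -> (forall x, x \in L -> x < n) ->
  block_list bs m -> block_members (fun x => x < n) m -> blocks_of n blk bs ->
  (forall b, b \in bs -> b < regs m v_nb) ->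
  (forall c, arrs m a_seen c < regs m v_now) ->
  wp Defs.split m (fun t m' => [/\ t <= 57 * n + 7,
    block_members (fun x => x < n) m',
    forall c, arrs m' a_seen c <= regs m v_now,
    forall x y, x < n -> y < n -> arrs m' a_blk x = arrs m' a_blk y <->
      blk x = blk y /\ (x \in L) = (y \in L) &
    exists T app, [/\
      let bs' := [seq b <- bs | b \notin T] ++ app in
      [/\ block_list bs' m', blocks_of n (arrs m' a_blk) bs' &
          forall b, b \in bs' -> b < regs m' v_nb],
      uniq T /\ {subset T <= bs},
      size app = 2 * size T,
      forall b x, b \in bs -> b \notin T -> x < n ->
        (arrs m' a_blk x == b) = (blk x == b) &
      forall b, b \in T -> exists2 x, x < n & blk x = b /\ x \notin L]]).
Proof.
move=> blk coL uL ltL bl ok bsP nb_lt seen_lt.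
have sL : size L <= n.
  rewrite -[n](size_iota 0); apply: uniq_leq_size => // x /ltL.
  by rewrite mem_iota.
have blk_bs x : x < n -> blk x \in bs by move=> xn; apply/bsP; exists x.
apply: wp_seq; apply: wp_assign; set m0 := store _ _ _.
apply: wp_seq; apply: wp_conseq.
  apply: wp_frame; exact: (@touch_loop_wp L m0 coL erefl seen_lt).
move=> t1 m1 [[le1 [TL [ntE touchE uTL memTL hitTL]] seen1] [fr1 fa1]].
have bl1 : block_list bs m1.
  by rewrite /block_list (fa1 a_bnext isT) (fa1 a_bprev isT) (fr1 v_first isT)
    (fr1 v_last isT).
have nb1 : regs m1 v_nb = regs m v_nb by rewrite (fr1 v_nb isT).
have subTL : {subset TL <= bs}.
  by move=> C; rewrite memTL => /mapP[x /ltL xn ->]; apply: blk_bs.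
apply: wp_seq; apply: wp_conseq.
  apply: wp_frame; apply: (@twin_loop_wp bs TL m1) => //.
  by rewrite nb1.
move=> t2 m2 [[le2 /= [[app] [bl2 nb2 sapp appP TP] twP]] [fr2 fa2]].
move: bl2 nb2 sapp appP TP twP; set T := filter _ TL; rewrite nb1.
set nb := regs m v_nb; set tw := arrs m2 a_twin => bl2 nb2 sapp appP TP twP.
have blk2 : arrs m2 a_blk = blk by rewrite (fa2 a_blk isT) (fa1 a_blk isT).
have ok2 : block_members (fun x => x < n) m2.
  rewrite /block_members blk2 (fa2 a_mnext isT) (fa2 a_mprev isT) (fa2 a_mhead isT)
   (fa2 a_size isT) (fa1 a_mnext isT) (fa1 a_mprev isT) (fa1 a_mhead isT).
  by rewrite (fa1 a_size isT).
have coL2 : collected L m2.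
  by rewrite /collected (fr2 v_len isT) (fa2 a_reach isT) (fr1 v_len isT) (fa1 a_reach isT).
apply: wp_conseq; first exact: wp_frame (move_loop_wp coL2 uL ltL ok2).
move=> t3 m3 [[le3 ok3 blk3] [fr3 fa3]].
rewrite blk2 -/tw in blk3.
have sTL : size TL <= n.
  have : size TL <= size [seq blk x | x <- L].
    by apply: uniq_leq_size => // C; rewrite memTL.
  by rewrite size_map; lia.
have uT : uniq T by apply: filter_uniq.
have subT : {subset T <= TL} by move=> C; rewrite mem_filter => /andP[].
have nb_T C : C \in T -> C < nb by move=> /subT/subTL/nb_lt.
(* Counting: if all states of [C] were in [L], the number of hits would equal the size of [C]. Hence
   the old block keeps a state and stays inhabited. *)
have sizeE C : C \in T -> exists2 x, x < n & blk x = C /\ x \notin L.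
  move=> CT; move: (CT); rewrite mem_filter => /andP[+ CTL]; rewrite hitTL //.
  rewrite (fa1 a_size isT); have [mem okm] := ok; have [_ um memE ->] := okm C.
  rewrite -size_filter => lt.
  have [/allP sub|/allPn[x mx xL]] := boolP (all (fun x => x \in L) (mem C)).
    have : size (mem C) <= size [seq x <- L | blk x == C].
      apply: uniq_leq_size => // x mx; rewrite mem_filter sub // andbT.
      by move: mx; rewrite memE => /andP[].
    by rewrite leqNgt lt.
  by move: mx; rewrite memE => /andP[xn /eqP xC]; exists x.
(* Conversely, when the hits are at least as many as the states of [C], the repetition-free list of
   hits exhausts [C]. *)
have untouched C x : C \notin T -> C \in TL -> x < n -> blk x = C -> x \in L.
  rewrite mem_filter => + CTL xn xC; rewrite CTL andbT -leqNgt hitTL //.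
  rewrite (fa1 a_size isT); have [mem okm] := ok; have [_ um memE ->] := okm C.
  rewrite -size_filter => le.
  have [||_ e] := @uniq_min_size _ [seq x <- L | blk x == C] (mem C) _ _ le.
  - exact: filter_uniq.
  - by move=> y; rewrite mem_filter memE => /andP[-> /ltL ->].
  by have := e x; rewrite memE -/blk xn xC eqxx mem_filter => /andP[].
have blk3E x : x < n -> arrs m3 a_blk x =
    if (x \in L) && (blk x \in T) then (tw (blk x)).-1 else blk x.
  move=> xn; rewrite blk3; case xL: (x \in L) => //=; rewrite twP //.
  by rewrite memTL; apply: map_f.
have twL C : C \in T -> nb <= (tw C).-1 < nb + size T /\ tw C = (tw C).-1.+1.
  by move=> CT; have [_ + _ _] := TP C CT; lia.
have partE x y : x < n -> y < n -> arrs m3 a_blk x = arrs m3 a_blk y <->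
      blk x = blk y /\ (x \in L) = (y \in L).
  move=> xn yn; rewrite !blk3E //; have nx := nb_lt _ (blk_bs x xn).
  have ny := nb_lt _ (blk_bs y yn); rewrite -/nb in nx ny.
  split; last by move=> [-> ->].
  (* If exactly one of the two states is moved, its new number is at least [nb] and the other one is
     below. If both are moved, injectivity of the twins applies; if neither is, a difference in [L]
     contradicts [untouched]. *)
  case xL: (x \in L); case yL: (y \in L); case xT: (blk x \in T); case yT: (blk y \in T) => //= e.
  - split=> //; have [_ _ _ i] := TP _ xT; apply: i => //.
    by have [_ ->] := twL _ xT; have [_ ->] := twL _ yT; rewrite e.
  - by have [] := twL _ xT; lia.
  - by have [] := twL _ yT; lia.
  - by have [] := twL _ xT; lia.
  - by have [] := twL _ xT; lia.
  - by rewrite e yT in xT.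
  - suff : y \in L by rewrite yL.
    apply: (untouched (blk x)) => //; first by rewrite xT.
    by rewrite memTL; apply: map_f.
  - by have [] := twL _ yT; lia.
  - by rewrite e yT in xT.
  - by have [] := twL _ yT; lia.
  - suff : x \in L by rewrite xL.
    apply: (untouched (blk y)) => //; first by rewrite yT.
    by rewrite memTL; apply: map_f.
split=> //.
- lia.
- move=> c; rewrite (fa3 a_seen isT) (fa2 a_seen isT); exact: seen1.
exists T, app; split=> //.
- rewrite /=; split.
  + rewrite /block_list (fa3 a_bnext isT) (fa3 a_bprev isT) (fr3 v_first isT).
    by rewrite (fr3 v_last isT).
  + move=> b; rewrite mem_cat mem_filter; split.
      have touchedP C : C \in T -> exists2 x, x \in L & blk x = C.
        by move=> /subT; rewrite memTL => /mapP[x xL ->]; exists x.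
      case/orP=> [/andP[nT /bsP[x xn xb]]|/appP[bT|[C CT Cb]]].
      * by exists x; rewrite // blk3E // xb (negPf nT) andbF.
      * have [x xn [xb /negPf xL]] := sizeE _ bT.
        by exists x; rewrite // blk3E // xL.
      * have [x xL xC] := touchedP _ CT; exists x; first exact: ltL.
        by rewrite blk3E ?xL ?xC ?CT ?Cb // ltL.
    move=> [x xn <-]; rewrite blk3E //.
    case xT: (blk x \in T); rewrite ?andbF ?andbT.
      by have [a1 _ a2 _] := TP _ xT; case: ifP; rewrite ?a1 ?a2 orbT.
    by rewrite xT blk_bs.
  + move=> b; rewrite (fr3 v_nb isT) nb2 mem_cat mem_filter.
    case/orP=> [/andP[_ /nb_lt]|/appP[/nb_T|[C CT Cb]]].
    * by rewrite -/nb; lia.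
    * by lia.
    * by have [] := twL _ CT; rewrite Cb /=; lia.
- by split=> // C /subT/subTL.
- move=> b x bbs bT xn; rewrite blk3E //; case: ifP => // /andP[xL xT].
  have := nb_lt _ bbs; have [] := twL _ xT; rewrite -/nb => tb _ bn.
  have -> : ((tw (blk x)).-1 == b) = false by lia.
  by case: eqP => // e; rewrite -e xT in bT.
Qed.

(** * The refinement loop *)

Definition refine_loop : cmd := (
  WHILE v_cur != 0 DO
    v_B <~ v_cur.-1 ;;
    mark_block_components ;;
    collect_EF ;;
    Defs.split ;;
    v_cur <~ a_bnext!!v_B
  DONE)%cmd.

Section Refine.

Variables (n M : nat) (src tgt : nat -> nat) (R : nat -> nat -> Prop).
Variable (blk0 : nat -> nat) (definable : (nat -> Prop) -> Prop).

Definition pre_EF (P : nat -> Prop) (x : nat) : Prop :=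
  exists2 z, z < n & P z /\ R x z.

Hypothesis R_refl : forall x, R x x.
Hypothesis R_trans : forall x y z, R x y -> R y z -> R x z.
Hypothesis R_edge : forall j, j < M -> R (src j) (tgt j).
(** Says that [R] is generated by the transitions; it turns closure under predecessors into
    completeness of the search. *)
Hypothesis R_ind : forall P : pred nat, (forall j, j < M -> P (tgt j) -> P (src j)) ->
  forall x z, R x z -> P z -> P x.
Hypothesis src_lt : forall j, j < M -> src j < n.
Hypothesis tgt_lt : forall j, j < M -> tgt j < n.

Hypothesis definable_ext : forall P Q,
  (forall x, x < n -> P x <-> Q x) -> definable P -> definable Q.
Hypothesis definable_and : forall P Q,
  definable P -> definable Q -> definable (fun x => P x /\ Q x).
Hypothesis definable_not : forall P, definable P -> definable (fun x => ~ P x).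
Hypothesis definable_EF : forall P, definable P -> definable (pre_EF P).

Definition components_ok (m : memory) : Prop :=
  exists cls preds,
  [/\ linked_lists (arrs m a_cnext) (arrs m a_chead) cls /\
        (forall c, uniq (cls c)) /\
        (forall c x, c != 0 -> (x \in cls c) = (x < n) && (arrs m a_comp x == c)),
      forall x, x < n -> arrs m a_comp x != 0,
      forall x y, x < n -> arrs m a_comp x = arrs m a_comp y -> R x y,
      linked_lists (arrs m a_dnext) (arrs m a_dhead) preds /\
        (forall d, uniq (preds d)) /\
        (forall d j, (j \in preds d) =
          [&& j < M, arrs m a_comp (src j) != arrs m a_comp (tgt j) &
              arrs m a_comp (tgt j) == d]) &
      forall j, j < M -> arrs m a_comp (src j) != arrs m a_comp (tgt j) ->
        arrs m a_dsrc j = arrs m a_comp (src j)].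

Definition in_block (blk : nat -> nat) (b : nat) : nat -> Prop := fun x => blk x = b.

Definition stable_for (blk : nat -> nat) (b : nat) : Prop :=
  forall x y, x < n -> y < n -> blk x = blk y ->
  pre_EF (in_block blk b) x -> pre_EF (in_block blk b) y.

(** The cursor cuts the list of blocks into the scanned entries [pre] and the entries ahead [rest];
    stability is claimed for [pre] only. *)
Record refine_inv (pre rest : seq nat) (m : memory) : Prop := RefineInv {
  ri_list : block_list (pre ++ rest) m;
  ri_members : block_members (fun x => x < n) m;
  ri_blocks : blocks_of n (arrs m a_blk) (pre ++ rest);
  ri_cur : linked_list (arrs m a_bnext) (regs m v_cur) rest;
  ri_nb : forall b, b \in pre ++ rest -> b < regs m v_nb;
  ri_seen : forall c, arrs m a_seen c <= regs m v_now;
  ri_mark : forall c, arrs m a_mark c <= regs m v_now;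
  ri_stable : forall b, b \in pre -> stable_for (arrs m a_blk) b;
  ri_refines : forall x y, x < n -> y < n ->
    arrs m a_blk x = arrs m a_blk y -> blk0 x = blk0 y;
  ri_definable : forall x, x < n ->
    definable (in_block (arrs m a_blk) (arrs m a_blk x))
}.

(** The time adds $7n+4$ for marking, $12n+7M+2$ for the search, $57n+7$ for splitting and 2 for the
    assignments around them. *)
Lemma refine_step_wp pre rest m :
  components_ok m -> refine_inv pre rest m -> regs m v_cur <> 0 ->
  wp (v_B <~ v_cur.-1 ;;
    mark_block_components ;;
    collect_EF ;;
    Defs.split ;;
    v_cur <~ a_bnext!!v_B)%cmd m (fun t m' => exists pre' rest',
    [/\ refine_inv pre' rest' m', t <= 76 * n + 7 * M + 15 &
        size rest' + 2 * (n - size (pre' ++ rest')) <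
        size rest + 2 * (n - size (pre ++ rest))]).
Proof.
move=> [cls [preds [[llc [ucls clsP]] comp_nz conn [llp [upreds predsP]] dsrcP]]].
move=> [bl ok bsP curE nb_lt seen_le mark_le stab ref dfn] cur0.
have [rest' [restE ll']] := linked_list_nz curE cur0.
set B := (regs m v_cur).-1 in restE ll'; subst rest.
set blk := arrs m a_blk in bsP stab ref dfn; set comp := arrs m a_comp in clsP comp_nz conn predsP dsrcP.
set bs := pre ++ B :: rest' in bl bsP nb_lt.
have Bbs : B \in bs by rewrite mem_cat mem_head orbT.
have [mem okm] := ok; have [[l d] um memE _] := okm B.
have sm : size (mem B) <= n.
  rewrite -[n](size_iota 0); apply: uniq_leq_size => // x.
  by rewrite memE mem_iota => /andP[].
apply: wp_seq; apply: wp_assign; set m1 := store _ _ _.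
have llm : linked_list (arrs m1 a_mnext) (arrs m1 a_mhead (regs m1 v_B)) (mem B).
  exact: dseg_linked d.
apply: wp_seq; apply: wp_conseq.
  exact: wp_frame (mark_block_components_wp llm mark_le).
move=> t2 m2 [[le2 now2 [W [okW memW]]] [fr2 fa2]].
pose E := pre_EF (in_block blk B).
have E_comp x y : x < n -> comp x = comp y -> E y -> E x.
  move=> xn e [z zn [zB Ryz]]; exists z => //; split=> //.
  by apply: R_trans Ryz; apply: conn.
have E_edge j : j < M -> E (tgt j) -> E (src j).
  by move=> jM [z zn [zB Rz]]; exists z => //; split=> //; apply: R_trans (R_edge jM) Rz.
have comp2 : arrs m2 a_comp = comp by rewrite (fa2 a_comp isT).
have WE c : c \in W -> component_of_E n comp E c.
  rewrite memW => /mapP[x]; rewrite memE => /andP[xn /eqP xB] ->.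
  by exists x; last (split=> //; exists x).
apply: wp_seq; apply: wp_conseq.
  apply: wp_frame.
  apply: (collect_EF_wp clsP ucls predsP upreds comp_nz tgt_lt src_lt E_comp E_edge comp2) okW WE.
  - by rewrite (fa2 a_cnext isT) (fa2 a_chead isT).
  - by rewrite (fa2 a_dnext isT) (fa2 a_dhead isT).
  - by rewrite (fa2 a_dsrc isT).
move=> t3 m3 [[le3 [L [coL uL LE WL [Lclo mark3]]]] [fr3 fa3]].
(* Induction along [R]: the list is closed under predecessors and contains [B], so it contains all
   that reaches [B]. *)
have LP x : x < n -> (x \in L) <-> E x.
  move=> xn; split; first by case/LE.
  move=> [z zn [zB Rxz]]; apply: (R_ind (P := fun x => x \in L) Lclo) Rxz _.
  by apply: WL => //; rewrite memW; apply/map_f; rewrite memE zn -/blk zB eqxx.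
have blk3 : arrs m3 a_blk = blk by rewrite (fa3 a_blk isT) (fa2 a_blk isT).
have now3 : regs m3 v_now = (regs m v_now).+1 by rewrite (fr3 v_now isT) now2.
have nb3 : regs m3 v_nb = regs m v_nb by rewrite (fr3 v_nb isT) (fr2 v_nb isT).
have bl3 : block_list bs m3.
  rewrite /block_list (fa3 a_bnext isT) (fa3 a_bprev isT) (fr3 v_first isT) (fr3 v_last isT).
  by rewrite (fa2 a_bnext isT) (fa2 a_bprev isT) (fr2 v_first isT) (fr2 v_last isT).
have ok3 : block_members (fun x => x < n) m3.
  rewrite /block_members blk3 (fa3 a_mnext isT) (fa3 a_mprev isT) (fa3 a_mhead isT).
  by rewrite (fa3 a_size isT) (fa2 a_mnext isT) (fa2 a_mprev isT) (fa2 a_mhead isT) (fa2 a_size isT).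
apply: wp_seq; apply: wp_conseq.
  apply: wp_frame; apply: (@split_wp n bs L m3 coL uL _ bl3 ok3).
  - by move=> x /LE[].
  - by rewrite blk3.
  - by rewrite nb3.
  - by move=> c; by rewrite (fa3 a_seen isT) (fa2 a_seen isT) now3 ltnS; apply: seen_le.
move=> t4 m4 [[le4 ok4 seen4 partE [T [app [[bl4 bsP4 nb4] [uT subT] sapp sameE TP]]]] [fr4 fa4]].
rewrite blk3 in partE sameE TP; apply: wpfW => /=.
rewrite (fr4 v_B isT) (fr3 v_B isT) (fr2 v_B isT) /= -/B.
have BL x : x < n -> blk x = B -> x \in L.
  by move=> xn xB; apply/(LP x xn); exists x => //; split.
have BT : B \notin T by apply/negP => /TP[x xn [xB /negP[]]]; apply: BL.
have ubs : uniq bs by case: bl.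
set bs' := _ ++ app in bl4 bsP4 nb4.
pose pre' := rcons [seq b <- pre | b \notin T] B.
pose rest2 := [seq b <- rest' | b \notin T] ++ app.
have bs'E : bs' = pre' ++ rest2.
  by rewrite /bs' /bs /pre' /rest2 filter_cat /= BT cat_rcons -catA.
exists pre', rest2; split; last first.
(* Listed blocks are inhabited, so their number stays at most [n] and the truncated subtraction is
   exact. The entries ahead lose [B] and gain at most [2 * size T], while [size T] new blocks lower
   the second term by [2 * size T]. *)
- have : size bs' <= n by case: bl4 => _ u4; exact: size_blocks u4 bsP4.
  have szf (s : seq nat) : size [seq b <- s | b \notin T] + count (fun b => b \in T) s = size s.
    by rewrite size_filter addnC -(count_predC (fun b => b \in T)).
  have cT : count (fun b => b \in T) bs = size T.
    rewrite -size_filter; apply/perm_size/uniq_perm => //; first exact: filter_uniq.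
    by move=> b; rewrite mem_filter; case bT: (b \in T) => //=; apply: subT.
  rewrite -bs'E /bs' size_cat sapp /rest2 size_cat sapp.
  move: cT (szf bs) (szf rest'); rewrite /bs count_cat /= (negPf BT) !size_cat /=; lia.
- lia.
have preE b x : b \in pre' -> x < n -> (arrs m4 a_blk x == b) = (blk x == b).
  move=> bp xn; apply: sameE => //.
    by move: bp; rewrite mem_rcons inE mem_filter mem_cat => /predU1P[->|/andP[_ ->]//]; rewrite mem_head orbT.
  by move: bp; rewrite mem_rcons inE mem_filter => /predU1P[->|/andP[]].
have preEF b x : b \in pre' ->
    pre_EF (in_block (arrs m4 a_blk) b) x <-> pre_EF (in_block blk b) x.
  move=> bp; split=> -[z zn [/eqP zb Rxz]]; exists z => //; split=> //; apply/eqP.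
    by rewrite -preE.
  by rewrite preE.
split=> //=.
- by rewrite -bs'E.
- by rewrite -bs'E.
- case: bl4 => + _; rewrite bs'E /pre' -cats1 -catA => /dseg_cat[l' [q' [_ /=]]].
  by case=> _ _ /dseg_linked.
- by rewrite -bs'E.
- by move=> c; rewrite (fr4 v_now isT); apply: seen4.
- by move=> c; rewrite (fa4 a_mark isT) (fr4 v_now isT).
(* A block of [pre'] keeps its states, and equal new blocks come from equal old ones, so earlier
   stability survives. For [B] itself, stability is the separation along [L] just performed. *)
- move=> b bp x y xn yn /partE -/(_ xn yn)[e exy] /(preEF _ _ bp) EFx; apply/(preEF _ _ bp).
  move: (bp); rewrite mem_rcons inE => /predU1P[bB|]; last first.
    by rewrite mem_filter => /andP[_ bpre]; apply: stab EFx.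
  by move: EFx; rewrite bB => /(LP x xn); rewrite exy => /(LP y yn).
- by move=> x y xn yn /partE -/(_ xn yn)[e _]; apply: ref.
(* A new block is an old one intersected with [E] or with its complement. *)
- move=> x xn; have dE : definable E.
    by have [z zn zB] := (bsP B).1 Bbs; rewrite /E -zB; apply/definable_EF/dfn.
  case xL: (x \in L).
    apply: definable_ext (definable_and (dfn x xn) dE) => y yn; split.
      by move=> [yx /(LP y yn) yL]; apply/partE => //; rewrite xL yL.
    by move=> /partE -/(_ yn xn)[yx]; rewrite xL => /(LP y yn).
  apply: definable_ext (definable_and (dfn x xn) (definable_not dE)) => y yn; split.
    move=> [yx nE]; apply/partE => //; split=> //; rewrite xL.
    by apply/negP => /(LP y yn).
  move=> /partE -/(_ yn xn)[yx]; rewrite xL => yL; split=> // /(LP y yn).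
  by rewrite yL.
Qed.

Lemma refine_loop_wp bs m :
  components_ok m -> refine_inv [::] bs m ->
  wp refine_loop m (fun t m' => t <= (76 * n + 7 * M + 16) * (2 * n) + 1 /\
    exists bs', [/\ block_list bs' m', block_members (fun x => x < n) m',
      blocks_of n (arrs m' a_blk) bs',
      forall b, b \in bs' -> stable_for (arrs m' a_blk) b &
      (forall x y, x < n -> y < n ->
        arrs m' a_blk x = arrs m' a_blk y -> blk0 x = blk0 y) /\
      forall x, x < n -> definable (in_block (arrs m' a_blk) (arrs m' a_blk x))]).
Proof.
move=> co inv0.
pose I (g : seq nat * seq nat) m' := refine_inv g.1 g.2 m'.
pose phi (g : seq nat * seq nat) := size g.2 + 2 * (n - size (g.1 ++ g.2)).
apply: (wp_while (I := I) (phi := fun g => (76 * n + 7 * M + 16) * phi g) (g0 := ([::], bs))) => //.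
- move=> [pre rest] m' inv' [fr fa] /= /eqP cur0.
  have co' : components_ok m'.
    by rewrite /components_ok (fa a_cnext isT) (fa a_chead isT) (fa a_comp isT)
      (fa a_dnext isT) (fa a_dhead isT) (fa a_dsrc isT).
  apply: wp_conseq; first exact: refine_step_wp co' inv' cur0.
  move=> t m2 [pre2 [rest2 [inv2 le lt]]]; exists (pre2, rest2) => //.
  rewrite -/(phi (pre2, rest2)) -/(phi (pre, rest)) in lt.
  have := leq_mul (leqnn (76 * n + 7 * M + 16)) lt; rewrite mulnS; lia.
- move=> [pre rest] m' t inv' [fr fa] /= /negPn/eqP cur0 le.
  have rest0 : rest = [::] by have := ri_cur inv'; rewrite cur0 => /linked_list0.
  rewrite rest0 in inv'; split.
    have sbs : size bs <= n.
      by have [_ u] := ri_list inv0; apply: size_blocks u (ri_blocks inv0).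
    (* At the start the potential is twice [n] minus the number of blocks. *)
    have lep : phi ([::], bs) <= 2 * n by rewrite /phi /=; lia.
    have := leq_mul (leqnn (76 * n + 7 * M + 16)) lep; lia.
  move: inv' => [] /=; rewrite !cats0 => bl ok bsP _ _ _ _ st rf df.
  by exists pre.
Qed.

End Refine.

(** * Correctness of the final partition *)

Section Definable.

Variable K : kripke.

(* The two trivial sets are listed because without atoms there are no formulas. *)
Definition definable_set (X : {set K}) : Prop :=
  [\/ exists phi : form (atom K), sem phi = X, X = [set: K] | X = set0].

Lemma definable_setI X Y :
  definable_set X -> definable_set Y -> definable_set (X :&: Y).
Proof.
case=> [[phi <-]|->|->]; last by rewrite set0I; constructor 3.
  case=> [[psi <-]|->|->]; first by constructor 1; exists (And phi psi).
    by rewrite setIT; constructor 1; exists phi.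
  by rewrite setI0; constructor 3.
by rewrite setTI.
Qed.

Lemma definable_setC X : definable_set X -> definable_set (~: X).
Proof.
case=> [[phi <-]|->|->]; first by constructor 1; exists (Neg phi).
  by rewrite setCT; constructor 3.
by rewrite setC0; constructor 2.
Qed.

Lemma definable_setEF X : definable_set X -> definable_set (EF X).
Proof.
case=> [[phi <-]|->|->]; first by constructor 1; exists (FEF phi).
  by constructor 2; apply/setP => s; rewrite !inE; apply/exists_inP; exists s; rewrite ?inE.
by constructor 3; apply/setP => s; rewrite !inE; apply/exists_inP => -[t]; rewrite inE.
Qed.

(** Starting from the full set, each of the finitely many states outside [X] is cut off by an atom
    on which its label differs from that of [s], or by the negation of that atom. Such an atom is
    obtained by classical logic, since equality of labels is not decidable. *)
Lemma definable_label_class (X : {set K}) (s : K) :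
  (forall t, t \in X <-> label s =1 label t) -> definable_set X.
Proof.
move=> XP.
have sep (ts : seq K) : {in ts, forall t, t \notin X} ->
    exists Y, [/\ definable_set Y, X \subset Y & {in ts, forall t, t \notin Y}].
  elim: ts => [_|t ts IH out].
    by exists [set: K]; split; [constructor 2 | apply: subsetT |].
  have [|Y [dY XY outY]] := IH; first by move=> u us; apply: out; rewrite inE us orbT.
  have [p np] : exists p, label s p <> label t p.
    by apply: not_all_ex_not => e; have /negP[] := out t (mem_head _ _); apply/XP.
  exists (Y :&: [set u | label u p == label s p]); split.
  - apply: definable_setI => //; case sp: (label s p).
      by constructor 1; exists (Atom p); apply/setP => u; rewrite !inE eqb_id.
    constructor 1; exists (Neg (Atom p)); apply/setP => u; rewrite !inE.
    by case: (label u p).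
  - rewrite subsetI XY; apply/subsetP => u /XP e; by rewrite inE e.
  - move=> u; rewrite inE => /predU1P[->|us].
      by rewrite !inE negb_and orbC; case: eqP => // e; case: np.
    by rewrite inE negb_and outY.
have [|Y [dY XY outY]] := sep (enum (~: X)).
  by move=> t; rewrite mem_enum inE.
suff -> : X = Y by [].
apply/eqP; rewrite eqEsubset XY; apply/subsetP => t; apply: contraTT => tX.
by apply: outY; rewrite mem_enum inE.
Qed.

Lemma definable_strongly_preserved (Q : {set {set K}}) X B s t :
  strongly_preserves Q -> B \in Q -> s \in B -> t \in B ->
  definable_set X -> s \in X -> t \in X.
Proof.
move=> spQ BQ sB tB [[phi <-]|->|->]; rewrite ?inE // => sphi.
by rewrite -(spQ B BQ s t sB tB).
Qed.

End Definable.

(** * From numbers to states, reachability and formulas *)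

Section Numbering.

Variables (K : kripke) (es : seq (K * K)).
Hypothesis esE : es =i transitions K.

Definition src_number : nat -> nat := nth 0 [seq state_number e.1 | e <- es].
Definition tgt_number : nat -> nat := nth 0 [seq state_number e.2 | e <- es].

(** The first disjunct makes the relation reflexive on all numbers, including those that number no
    state. *)
Definition reach_number (u v : nat) : Prop :=
  u = v \/ exists s t : K,
    [/\ state_number s = u, state_number t = v & connect (@trans K) s t].

Lemma state_number_lt (s : K) : state_number s < #|K|.
Proof. exact: ltn_ord. Qed.

Lemma state_number_inj : injective (@state_number K).
Proof. by move=> s t /ord_inj/enum_rank_inj. Qed.

Lemma state_numberP x : x < #|K| -> exists s : K, state_number s = x.
Proof.
by move=> xn; exists (enum_val (Ordinal xn)); rewrite /state_number enum_valK.
Qed.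

Lemma edge_number j : j < size es -> exists s t : K,
  [/\ src_number j = state_number s, tgt_number j = state_number t & trans s t].
Proof.
rewrite /src_number /tgt_number => lt; case: es lt esE => [//|e0 es'] lt eE.
set e := nth e0 (e0 :: es') j.
have : e \in e0 :: es' by apply: mem_nth.
by rewrite eE inE => tr; exists e.1, e.2; rewrite !(nth_map e0) // -/e.
Qed.

Lemma src_number_lt j : j < size es -> src_number j < #|K|.
Proof. by move=> /edge_number[s [t [-> _ _]]]; apply: state_number_lt. Qed.

Lemma tgt_number_lt j : j < size es -> tgt_number j < #|K|.
Proof. by move=> /edge_number[s [t [_ -> _]]]; apply: state_number_lt. Qed.

Lemma reach_number_refl x : reach_number x x.
Proof. by left. Qed.

Lemma reach_number_trans x y z :
  reach_number x y -> reach_number y z -> reach_number x z.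
Proof.
move=> [->//|[s [t [sx ty st]]]] [<-|[t' [u [t'y uz tu]]]].
  by right; exists s, t.
have e : t = t' by apply: state_number_inj; rewrite ty t'y.
by right; exists s, u; split=> //; apply: connect_trans st _; rewrite e.
Qed.

Lemma reach_number_edge j : j < size es -> reach_number (src_number j) (tgt_number j).
Proof.
by move=> /edge_number[s [t [-> -> st]]]; right; exists s, t; split=> //; apply: connect1.
Qed.

(** A path is followed from its end; each of its steps is the transition found at its index in
    [es]. *)
Lemma reach_number_ind (P : pred nat) :
  (forall j, j < size es -> P (tgt_number j) -> P (src_number j)) ->
  forall x z, reach_number x z -> P z -> P x.
Proof.
move=> step x z [->//|[s [t [<- <- /connectP[p pth ->]]]]].
elim: p s pth => //= u p IH s /andP[su pth] Plast.
have Pu := IH u pth Plast.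
have sues : (s, u) \in es by rewrite esE inE.
have lt : index (s, u) es < size es by rewrite index_mem.
by have := step _ lt; rewrite /src_number /tgt_number !(nth_map (s, u)) // nth_index //=; apply.
Qed.

Lemma reach_numberE (s t : K) :
  reach_number (state_number s) (state_number t) <-> connect (@trans K) s t.
Proof.
split=> [[/state_number_inj->//|[s' [t' [/state_number_inj-> /state_number_inj->]]]]|st] //.
by right; exists s, t.
Qed.

Definition definable (P : nat -> Prop) : Prop :=
  exists2 X : {set K}, definable_set X & forall s, s \in X <-> P (state_number s).

Lemma definable_ext P Q : (forall x, x < #|K| -> P x <-> Q x) ->
  definable P -> definable Q.
Proof.
move=> PQ [X dX XP]; exists X => // s; split.
  by move=> /XP /(PQ _ (state_number_lt s)).
by move=> Qs; apply/XP/(PQ _ (state_number_lt s)).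
Qed.

Lemma definable_and P Q : definable P -> definable Q -> definable (fun x => P x /\ Q x).
Proof.
move=> [X dX XP] [Y dY YQ]; exists (X :&: Y); first exact: definable_setI.
by move=> s; rewrite inE; split=> [/andP[/XP ? /YQ]|[/XP-> /YQ->]].
Qed.

Lemma definable_not P : definable P -> definable (fun x => ~ P x).
Proof.
move=> [X dX XP]; exists (~: X); first exact: definable_setC.
by move=> s; rewrite inE; split=> [/negP nX /XP|nP]; last apply/negP => /XP.
Qed.

Lemma pre_EF_number P (X : {set K}) s :
  (forall t, t \in X <-> P (state_number t)) ->
  s \in EF X <-> pre_EF #|K| reach_number P (state_number s).
Proof.
move=> XP; rewrite inE; split.
  move=> /exists_inP[t /XP Pt st]; exists (state_number t); first exact: state_number_lt.
  by split=> //; apply/reach_numberE.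
move=> [z /state_numberP[t <-] [/XP tX /reach_numberE st]].
by apply/exists_inP; exists t.
Qed.

Lemma definable_EF P : definable P -> definable (pre_EF #|K| reach_number P).
Proof.
move=> [X dX XP]; exists (EF X); first exact: definable_setEF.
by move=> s; apply: pre_EF_number.
Qed.

(** By totality every state is the source of a chosen transition, and distinct states give distinct
    transitions. *)
Lemma card_states_le : uniq es -> #|K| <= size es.
Proof.
move=> ues; rewrite -(card_uniqP ues) (eq_card esE).
pose f (s : K) := (s, xchoose (trans_total s)).
have injf : injective f by move=> s t [].
rewrite -(card_codom injf); apply: subset_leq_card.
apply/subsetP => _ /codomP[s ->]; rewrite inE /=; exact: xchooseP.
Qed.

End Numbering.

Section Correctness.

Variables (K : kripke) (Pl : {set {set K}}) (blk0 : nat -> nat).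
Hypothesis PlP : label_partition Pl.
Hypothesis blk0P : forall s t : K,
  (blk0 (state_number s) == blk0 (state_number t)) = (t \in pblock Pl s).

Let n := #|K|.

Lemma initial_definable x : x < n -> definable K (in_block blk0 (blk0 x)).
Proof.
move=> /state_numberP[s <-]; exists (pblock Pl s).
  by apply: (@definable_label_class K _ s) => t; case: PlP => _ ->.
by move=> t; rewrite -blk0P /in_block; split=> [/eqP|->].
Qed.

Variables (blk : nat -> nat) (bs : seq nat) (mem : nat -> seq nat).
Hypothesis memE : forall b x, (x \in mem b) = (x < n) && (blk x == b).
Hypothesis bsP : blocks_of n blk bs.
Hypothesis stable : forall b, b \in bs -> stable_for n (@reach_number K) blk b.
Hypothesis refining : forall x y, x < n -> y < n -> blk x = blk y -> blk0 x = blk0 y.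
Hypothesis dfn : forall x, x < n -> definable K (in_block blk (blk x)).

Let block b := [set s : K | state_number s \in mem b].
Let P := [set B in [seq block b | b <- bs]].

Let in_blockE (s : K) b : (s \in block b) = (blk (state_number s) == b).
Proof. by rewrite inE memE state_number_lt. Qed.

Let blockP B : B \in P -> exists2 b, b \in bs & B = block b.
Proof. by rewrite inE => /mapP. Qed.

Let block_P (s : K) : block (blk (state_number s)) \in P.
Proof.
rewrite inE; apply/map_f/bsP; exists (state_number s) => //; exact: state_number_lt.
Qed.

Lemma final_coarsest : coarsest_strongly_preserving Pl P.
Proof.
have [partPl labPl] := PlP.
split.
- apply/and3P; split.
  + rewrite eqEsubset subsetT; apply/subsetP => s _; apply/bigcupP.
    by exists (block (blk (state_number s))); rewrite ?in_blockE.
  + apply/trivIsetP => _ _ /blockP[b _ ->] /blockP[c _ ->] neq.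
    rewrite -setI_eq0; apply/eqP/setP => s; rewrite inE !in_blockE in_set0.
    by apply/negP => /andP[/eqP-> /eqP e]; rewrite e eqxx in neq.
  + apply/negP => /blockP[b /bsP[x /state_numberP[s <-] sb] /setP/(_ s)].
    by rewrite in_blockE sb eqxx in_set0.
- move=> _ /blockP[b /bsP[x /state_numberP[s <-] sb] ->].
  exists (pblock Pl s); first by apply: pblock_mem; rewrite (cover_partition partPl) inE.
  apply/subsetP => t; rewrite in_blockE -sb -blk0P => /eqP e.
  by apply/eqP/refining; rewrite ?state_number_lt.
- move=> _ /blockP[b _ ->] s t; rewrite !in_blockE => /eqP sb /eqP tb phi.
  have: blk (state_number s) = blk (state_number t) by rewrite sb.
  move: s t {sb tb}; elim: phi => [p|phi1 IH1 phi2 IH2|phi1 IH|phi1 IH] s t e /=.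
  + rewrite !inE; apply: (labPl s t).1; rewrite -blk0P; apply/eqP/refining => //;
      exact: state_number_lt.
  + by rewrite !inE (IH1 s t) // (IH2 s t).
  + by rewrite !inE (IH s t).
  (* If [s1] reaches [u], stability for the block of [u] gives a state [v] of this block reached
     from [s2], and by induction [v] satisfies the subformula as [u] does. *)
  + have half s1 s2 : blk (state_number s1) = blk (state_number s2) ->
        s1 \in EF (sem phi1) -> s2 \in EF (sem phi1).
      move=> e12; rewrite !inE => /exists_inP[u uphi su].
      have ub : blk (state_number u) \in bs.
        by apply/bsP; exists (state_number u); rewrite ?state_number_lt.
      have [|z /state_numberP[v <-] [vb /reach_numberE sv]] :=
          stable ub (state_number_lt s1) (state_number_lt s2) e12.
        exists (state_number u); first exact: state_number_lt.
        by split=> //; apply/reach_numberE.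
      apply/exists_inP; exists v => //; by rewrite (IH v u vb).
    by apply/idP/idP; apply: half.
(* For [s] in [B], the final block of [s] is definable, so strong preservation by [Q] forces all of
   [B] into it. *)
- move=> Q partQ _ spQ B BQ.
  have [s sB] : exists s, s \in B.
    apply/set0Pn; apply: contraTneq BQ => ->; by case/and3P: partQ.
  exists (block (blk (state_number s))) => //; apply/subsetP => t tB.
  have [X dX XP] := dfn (state_number_lt s).
  rewrite in_blockE; apply/eqP/XP.
  by apply: definable_strongly_preserved spQ BQ sB tB dX _; apply/XP.
Qed.

End Correctness.

(** * Assembly of the phases and total running time *)

Theorem theorem5p5 :
  exists c : nat,
  forall (K : kripke) (Pl : {set {set K}}) (es : seq (K * K)) (blk : K -> nat),
  label_partition Pl -> is_input Pl es blk ->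
  exists (t : nat) (m : memory) (P : {set {set K}}),
  [/\ exec refine_EF (input_memory es blk) t m,
      is_output m P,
      coarsest_strongly_preserving Pl P &
      0 < #|K| -> t <= c * (#|K| * #|transitions K|)].
Proof.
(* The total time is at most $29M+78n+15+(76n+7M+16)\cdot 2n$. For $1\le n\le M$ each monomial is at
   most its coefficient times $nM$, and $29+78+15+152+14+32=320$. *)
exists 320 => K Pl es blk PlP [ues esE blk_lt blkE].
set n := #|K|; set M := size es; set m0 := input_memory es blk.
pose src := src_number es; pose tgt := tgt_number es; pose R := @reach_number K.
have MC : #|transitions K| = M by rewrite -(eq_card esE); apply/card_uniqP.
pose blk0 := arrs m0 a_blk.
have blk0E s : blk0 (state_number s) = blk s.
  rewrite /blk0 /= (nth_map s) ?nth_enum_rank //.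
  by rewrite -cardE state_number_lt.
have blk0P s t : (blk0 (state_number s) == blk0 (state_number t)) = (t \in pblock Pl s).
  by rewrite !blk0E blkE.
have srcn j : j < M -> src j < n by apply: src_number_lt.
have tgtn j : j < M -> tgt j < n by apply: tgt_number_lt.
have Redge j : j < M -> R (src j) (tgt j) by apply: reach_number_edge.
suff [t [m [[le [bs [[bl _] [mem ok] bsP st [rf df]]]] ex]]] :
    exists t m, (t <= 29 * M + 78 * n + 15 + (76 * n + 7 * M + 16) * (2 * n) /\
    exists bs, [/\ block_list bs m, block_members (fun x => x < n) m,
      blocks_of n (arrs m a_blk) bs,
      forall b, b \in bs -> stable_for n R (arrs m a_blk) b &
      (forall x y, x < n -> y < n ->
        arrs m a_blk x = arrs m a_blk y -> blk0 x = blk0 y) /\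
      forall x, x < n -> definable K (in_block (arrs m a_blk) (arrs m a_blk x))])
    /\ exec refine_EF m0 t m.
  exists t, m, [set B in [seq [set s : K | state_number s \in mem b] | b <- bs]].
  split=> //.
  - exists bs, mem; split=> //; first exact: dseg_linked bl.
    by move=> b _; have [[l d] _ _ _] := ok b; apply: dseg_linked d.
  - apply: (final_coarsest PlP blk0P) bsP st rf df => b x.
    by have [_ _ -> _] := ok b.
  (* With no states the run still takes positive time while the bound is zero; [0 < n] lets the
     lower-order terms be absorbed into [n * M]. *)
  rewrite MC => n0; have nM : n <= M := card_states_le esE ues.
  have nn : n * n <= n * M by rewrite leq_mul2l nM orbT.
  have Mn : M <= n * M by rewrite leq_pmull.
  by move: le; rewrite !mulnDl ![_ * (2 * n)]mulnCA -/n; nia.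
suff [t [m [ex q]]] : wp refine_EF m0 (fun t m =>
    t <= 29 * M + 78 * n + 15 + (76 * n + 7 * M + 16) * (2 * n) /\
    exists bs, [/\ block_list bs m, block_members (fun x => x < n) m,
      blocks_of n (arrs m a_blk) bs,
      forall b, b \in bs -> stable_for n R (arrs m a_blk) b &
      (forall x y, x < n -> y < n ->
        arrs m a_blk x = arrs m a_blk y -> blk0 x = blk0 y) /\
      forall x, x < n -> definable K (in_block (arrs m a_blk) (arrs m a_blk x))]).
  by exists t, m.
apply: wp_seq; apply: wp_conseq.
  by apply: wp_frame; apply: (@build_successors_wp n m0).
move=> t1 m1 [[le1 [adj [ll1 adjP adjS]]] [fr1 fa1]].
apply: wp_seq; apply: wp_conseq.
  apply: wp_frame.
  apply: (@tarjan_wp n M src tgt (arrs m1 a_anext) (arrs m1 a_ahead) R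
    (@reach_number_refl K) (@reach_number_trans K) Redge tgtn adj m1) => //.
  - by rewrite (fr1 v_n isT).
  - by rewrite (fr1 v_cur isT).
  - by rewrite (fr1 v_tp isT).
  - by rewrite (fa1 a_num isT).
  - by rewrite (fa1 a_comp isT).
  - by rewrite (fa1 a_chead isT).
  - by rewrite (fa1 a_tgt isT).
move=> t2 m2 [[le2 [cls [llc ucls clsP cnz conn]]] [fr2 fa2]].
apply: wp_seq; apply: wp_conseq.
  apply: wp_frame; apply: (@build_dag_wp m2).
  by move=> d; rewrite (fa2 a_dhead isT) (fa1 a_dhead isT).
move=> t3 m3 [[le3 [preds [lld upreds predsP dsrcP]]] [fr3 fa3]].
have src2 : arrs m2 a_src = src by rewrite (fa2 a_src isT) (fa1 a_src isT).
have tgt2 : arrs m2 a_tgt = tgt by rewrite (fa2 a_tgt isT) (fa1 a_tgt isT).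
have M2 : regs m2 v_m = M by rewrite (fr2 v_m isT) (fr1 v_m isT).
have M1 : regs m0 v_m = M by [].
rewrite src2 tgt2 M2 in le3 predsP dsrcP.
apply: wp_seq; apply: wp_conseq.
  apply: wp_frame; apply: (@build_blocks_wp n m3).
  - by rewrite (fr3 v_n isT) (fr2 v_n isT) (fr1 v_n isT).
  - by rewrite (fr3 v_first isT) (fr2 v_first isT) (fr1 v_first isT).
  - by rewrite (fr3 v_last isT) (fr2 v_last isT) (fr1 v_last isT).
  - by move=> b; rewrite (fa3 a_mhead isT) (fa2 a_mhead isT) (fa1 a_mhead isT).
  - by move=> b; rewrite (fa3 a_size isT) (fa2 a_size isT) (fa1 a_size isT).
have blk3 : arrs m3 a_blk = blk0 by rewrite (fa3 a_blk isT) (fa2 a_blk isT) (fa1 a_blk isT).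
rewrite blk3; move=> t4 m4 [[le4 nb4 blk4 ok4 [bs bl4 bsP4]] [fr4 fa4]].
apply: wp_seq; apply: wp_assign; set m5 := store _ _ _.
apply: wp_conseq.
  apply: (@refine_loop_wp n M src tgt R blk0 (definable K)
    (@reach_number_refl K) (@reach_number_trans K) Redge (reach_number_ind esE) srcn tgtn
    (@definable_ext K) (@definable_and K) (@definable_not K) (@definable_EF K) bs m5).
  - exists cls, preds.
    rewrite /= (fa4 a_cnext isT) (fa4 a_chead isT) (fa4 a_comp isT) (fa4 a_dnext isT)
      (fa4 a_dhead isT) (fa4 a_dsrc isT) (fa3 a_cnext isT) (fa3 a_chead isT) (fa3 a_comp isT).
    by split.
  - split=> //=.
    + by move=> b; rewrite bsP4; split=> -[x xn <-]; exists x; rewrite ?blk4.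
    + by case: bl4 => d _; apply: dseg_linked d.
    (* Input block names are below [n], which is the first number that a twin can receive. *)
    + move=> b /bsP4[x /state_numberP[s <-] <-]; rewrite nb4 blk0E; exact: blk_lt.
    + by move=> c; rewrite (fa4 a_seen isT) (fa3 a_seen isT) (fa2 a_seen isT) (fa1 a_seen isT).
    + by move=> c; rewrite (fa4 a_mark isT) (fa3 a_mark isT) (fa2 a_mark isT) (fa1 a_mark isT).
    + by move=> x y _ _; rewrite !blk4.
    + move=> x xn; have := initial_definable PlP blk0P xn.
      by apply: definable_ext => y yn; rewrite /in_block !blk4.
move=> t5 m6 [le5 [bs' [bl' ok' bsP' st' [rf' df']]]]; split; last by exists bs'.
rewrite M1 in le1; lia.
Qed.
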